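(* Let $k$ be a field, $X$ a well-ordered set, and let $S\subset Lie(X)\subset k\langle X\rangle$ be a nonempty set of monic Lie polynomials. Let $Id_{Lie}(S)$ be the Lie ideal of $Lie(X)$ generated by $S$, and let $Lie(X|S)=Lie(X)/Id_{Lie}(S)$. Then the following statements are equivalent. (i) $S$ is a Gröbner–Shirshov basis in $Lie(X)$. (ii) For every nonzero $f\in Id_{Lie}(S)$, one has $\bar f=a\bar s b$ for some $s\in S$ and $a,b\in X^*$. (ii') Every nonzero $f\in Id_{Lie}(S)$ can be written as a finite sum $f=\alpha_1[a_1s_1b_1]_{\bar s_1}+\alpha_2[a_2s_2b_2]_{\bar s_2}+\cdots$ of scalar multiples of normal $S$-words, where $\alpha_i\in k$, $s_i\in S$, $a_i,b_i\in X^*$, and $\bar f=a_1\bar s_1b_1>a_2\bar s_2b_2>\cdots$. (iii) The set $Red(S)=\{[u] \mid [u]\text{ is an NLSW},\ u\neq a\bar s b\text{ for all } s\in S,\ a,b\in X^*\}$ is a $k$-basis of $Lie(X|S)$ (that is, the family of cosets $[u]+Id_{Lie}(S)$, $[u]\in Red(S)$, is a $k$-basis).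
   Context: Words and orders. $X^*$ is the free monoid on $X$, $1$ is the empty word, $|u|$ is the length of $u$. The lexicographic order on $X^*$ is given by: $w>wt$ if $t\ne 1$, and $zxt_1>zyt_2$ if $x>y$ in $X$ (so a proper prefix is larger than the word). The deg-lex order on $X^*$ compares two words first by length and then lexicographically. All leading words and all inequalities between words in the claim and in the definitions of compositions, triviality and Gröbner–Shirshov bases below are with respect to deg-lex. ALSW. A nonempty word $u\in X^*$ is an ALSW (associative Lyndon–Shirshov word) if $vw>wv$ lexicographically whenever $u=vw$ with $v,w\ne 1$. NLSW. A non-associative word $(u)$ on $X$ (a bracketing of the word $u$) is an NLSW (non-associative Lyndon–Shirshov word) if: $u$ is an ALSW; if $(u)=((v)(w))$ then $(v)$ and $(w)$ are NLSWs; and if moreover $(v)=((v_1)(v_2))$ then $v_2\le w$ lexicographically. Each ALSW $u$ has exactly one bracketing that is an NLSW, denoted $[u]$. Lie polynomials. $k\langle X\rangle$ is the free associative algebra on $X$, regarded as a Lie algebra with bracket $(ab)=ab-ba$; $Lie(X)$ is the Lie subalgebra generated by $X$, and its elements are called Lie polynomials. Non-associative words are evaluated in $k\langle X\rangle$ by interpreting brackets as commutators. For nonzero $f\in k\langle X\rangle$, $\bar f\in X^*$ is the largest word occurring in $f$ with nonzero coefficient; $f$ is monic if that coefficient is $1$. The leading word of a nonzero Lie polynomial is an ALSW. Normal $S$-words. Let $u,v$ be ALSWs with $u=avb$, $a,b\in X^*$. Then (Shirshov) there is a factorization $b=cd$ such that in the bracketing $[u]$ the indicated subword $vc$ is a bracketed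 subword, i.e. $[u]=[a[vc]d]$; fix such a factorization for each triple $(a,v,b)$. Write $c=c_1\cdots c_m$ with ALSWs $c_1\le c_2\le\cdots\le c_m$ (lexicographically; this factorization is unique, and $m=0$ if $c=1$). The relative non-associative Lyndon–Shirshov word (RNLSW) $[u]_v$ is obtained from $[u]$ by replacing the bracketed subword $[vc]$ by $[\cdots[[[v][c_1]][c_2]]\cdots[c_m]]$. If $s$ is a monic Lie polynomial and $a\bar s b$ is an ALSW, then $[asb]_{\bar s}$ denotes the element obtained from $[a\bar s b]_{\bar s}$ by replacing the indicated subword $[\bar s]$ by $s$; it is called a normal $s$-word, or normal $S$-word if $s\in S$. Compositions. Let $f,g$ be monic Lie polynomials. (1) If $w=\bar f=a\bar g b$ for some $a,b\in X^*$, then $\langle f,g\rangle_w=f-[agb]_{\bar g}$ is a composition of inclusion. (2) If $w=\bar f b=a\bar g$ for some $a,b\in X^*$ with $|\bar f|+|\bar g|>|w|$, then $\langle f,g\rangle_w=[fb]_{\bar f}-[ag]_{\bar g}$ is a composition of intersection. (In both cases $w$ is an ALSW.) Gröbner–Shirshov basis in $Lie(X)$. A Lie polynomial $h$ is trivial modulo $(S,w)$ if $h=\sum_i\alpha_i[a_is_ib_i]_{\bar s_i}$ (finite sum) with $\alpha_i\in k$, $s_i\in S$, $a_i,b_i\in X^*$, each $[a_i\bar s_ib_i]_{\bar s_i}$ an RNLSW (in particular $a_i\bar s_ib_i$ an ALSW) and $a_i\bar s_ib_i<w$. A nonempty set $S$ of monic Lie polynomials is a Gröbner–Shirshov basis in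 $Lie(X)$ if every composition $\langle f,g\rangle_w$ with $f,g\in S$ is trivial modulo $(S,w)$. *)

(* Defs.v *)
From HB Require Import structures.
From mathcomp Require Import all_boot all_order all_algebra.
From mathcomp Require Import finmap.
From mathcomp Require Import monalg.

Set Implicit Arguments.
Unset Strict Implicit.
Unset Printing Implicit Defensive.

Import Order.TTheory GRing.Theory.
Local Open Scope ring_scope.

(* Words are sequences; concatenation is ++ and the empty word 1 is [::].
   The free algebra k<X> is the monoid algebra {malg k[{fmonom X}]} of the free
   monoid {fmonom X}, whose elements are wrapped sequences (FMonom). *)

Section Words.
Context {d : Order.disp_t} {X : orderType d}.
Implicit Types u v w : seq X.

(* A proper prefix is larger than the word: see lexltP. *)
Fixpoint lexlt u v : bool :=
  match u, v with
  | [::], _ => false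
  | _ :: _, [::] => true
  | x :: u', y :: v' => (x < y)%O || (x == y) && lexlt u' v'
  end.

Definition lexle u v : bool := (u == v) || lexlt u v.

Lemma lexltP u v :
  reflect ((exists2 t, t <> [::] & u = v ++ t) \/
           (exists z x y t1 t2,
              [/\ (x < y)%O, u = z ++ x :: t1 & v = z ++ y :: t2]))
          (lexlt u v).
Proof.
apply: (iffP idP).
- elim: u v => [|x u IHu] [|y v] //=; first by left; exists (x :: u).
  case/orP=> [xy|/andP[/eqP <- /IHu[]]].
  + by right; exists [::], x, y, u, v.
  + by case=> t t0 ->; left; exists t.
  + case=> [z [x' [y' [t1 [t2 [xy -> ->]]]]]].
    by right; exists (x :: z), x', y', t1, t2.
- case=> [[t t0 ->]|[z [x [y [t1 [t2 [xy -> ->]]]]]]].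
  + by elim: v => [|y v IHv] /=; [case: t t0 | rewrite ltxx eqxx].
  + by elim: z => [|c z IHz] /=; [rewrite xy | rewrite ltxx eqxx].
Qed.

Definition dlexlt u v : bool :=
  (size u < size v)%N || (size u == size v) && lexlt u v.

Definition dlexmax u v : seq X := if dlexlt u v then v else u.

Definition ALSW u : Prop :=
  u <> [::] /\
  forall v w, v <> [::] -> w <> [::] -> u = v ++ w -> lexlt (w ++ v) (v ++ w).

End Words.

Section NonAssociativeWords.
Context {d : Order.disp_t} {X : orderType d}.

Inductive naword : Type :=
| Leaf of X
| Node of naword & naword.

Fixpoint wordof (t : naword) : seq X :=
  match t with
  | Leaf x => [:: x]
  | Node l r => wordof l ++ wordof r
  end.

(* The NLSW t with wordof t = u is [u]. *)
Fixpoint NLSW (t : naword) : Prop :=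
  ALSW (wordof t) /\
  match t with
  | Leaf _ => True
  | Node v w =>
      [/\ NLSW v, NLSW w &
          match v with
          | Leaf _ => True
          | Node _ v2 => lexle (wordof v2) (wordof w)
          end]
  end.

(* Non-associative words with one hole: (C t) and (t C). *)
Inductive nactx : Type :=
| Hole
| CtxL of nactx & naword
| CtxR of naword & nactx.

Fixpoint fill (C : nactx) (t : naword) : naword :=
  match C with
  | Hole => t
  | CtxL C' r => Node (fill C' t) r
  | CtxR l C' => Node l (fill C' t)
  end.

Fixpoint ctxcomp (C D : nactx) : nactx :=
  match C with
  | Hole => D
  | CtxL C' r => CtxL (ctxcomp C' D) r
  | CtxR l C' => CtxR l (ctxcomp C' D)
  end.

Fixpoint lword (C : nactx) : seq X :=
  match C with
  | Hole => [::]
  | CtxL C' _ => lword C'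
  | CtxR l C' => wordof l ++ lword C'
  end.

Fixpoint rword (C : nactx) : seq X :=
  match C with
  | Hole => [::]
  | CtxL C' r => rword C' ++ wordof r
  | CtxR _ C' => rword C'
  end.

(* [avb] = C[t] = [a[vc]d]: the subword vc following a is the bracketed
   subword t. *)
Definition bracketed_at (a v b c : seq X) (C : nactx) (t : naword) : Prop :=
  [/\ NLSW (fill C t), wordof t = v ++ c, lword C = a & b = c ++ rword C].

(* phi a v b is the factor c of the factorization b = cd fixed for (a, v, b).
   Such a phi exists by choice alone: the existence of a factorization
   (Shirshov's lemma) is not presupposed. *)
Definition shirshov_choice (phi : seq X -> seq X -> seq X -> seq X) : Prop :=
  forall a v b, ALSW v -> ALSW (a ++ v ++ b) ->
    (exists c C t, bracketed_at a v b c C t) ->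
    exists C t, bracketed_at a v b (phi a v b) C t.

(* K is the RNLSW [avb]_v with its indicated subword [v] removed; in
   particular fill K [v] is [avb]_v. The list cs is [c_1], ..., [c_m], and
   foldl CtxL Hole cs is (..((_ [c_1]) [c_2])..[c_m]). *)
Definition rnlsw_ctx (phi : seq X -> seq X -> seq X -> seq X)
    (a v b : seq X) (K : nactx) : Prop :=
  [/\ ALSW v, ALSW (a ++ v ++ b) &
      exists C t (cs : seq naword),
        [/\ bracketed_at a v b (phi a v b) C t,
            (forall i, (i < size cs)%N -> NLSW (nth t cs i)),
            sorted lexle (map wordof cs),
            flatten (map wordof cs) = phi a v b &
            K = ctxcomp C (foldl CtxL Hole cs)]].

End NonAssociativeWords.

Arguments naword {d} X.
Arguments nactx {d} X.

Section LiePolynomials.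
Context {d : Order.disp_t} {X : orderType d} {k : fieldType}.
Local Notation kX := {malg k[{fmonom X}]}.
Implicit Types (f g h s : kX) (S : kX -> Prop) (w : seq X).

Definition lie_br f g : kX := f * g - g * f.

Definition gen (x : X) : kX := << fmu x >>.

Fixpoint naeval (t : naword X) : kX :=
  match t with
  | Leaf x => gen x
  | Node l r => lie_br (naeval l) (naeval r)
  end.

Fixpoint ctxeval (C : nactx X) s : kX :=
  match C with
  | Hole => s
  | CtxL C' r => lie_br (ctxeval C' s) (naeval r)
  | CtxR l C' => lie_br (naeval l) (ctxeval C' s)
  end.

Inductive Lie : kX -> Prop :=
| Lie_gen x : Lie (gen x)
| Lie_0 : Lie 0
| Lie_add f g : Lie f -> Lie g -> Lie (f + g)
| Lie_scale (c : k) f : Lie f -> Lie (c *: f)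
| Lie_br f g : Lie f -> Lie g -> Lie (lie_br f g).

Inductive IdLie S : kX -> Prop :=
| IdLie_gen s : S s -> IdLie S s
| IdLie_0 : IdLie S 0
| IdLie_add f g : IdLie S f -> IdLie S g -> IdLie S (f + g)
| IdLie_scale (c : k) f : IdLie S f -> IdLie S (c *: f)
| IdLie_br f g : IdLie S f -> Lie g -> IdLie S (lie_br f g).

(* The empty word is the deg-lex least word. By convention lead 0 = [::]. *)
Definition lead f : seq X :=
  \big[dlexmax/[::]]_(m <- msupp f) (m : seq X).

Definition dl_monic f : Prop := mcoeff (FMonom (lead f)) f = 1.

Section Choice.
Variable phi : seq X -> seq X -> seq X -> seq X.

(* h = [asb]_(lead s) *)
Definition normal_word (a : seq X) s (b : seq X) h : Prop :=
  exists2 K, rnlsw_ctx phi a (lead s) b K & h = ctxeval K s.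

(* h = <f, g>_w *)
Definition inclusion_comp f g w h : Prop :=
  exists a b h',
    [/\ w = lead f, w = a ++ lead g ++ b,
        normal_word a g b h' & h = f - h'].

Definition intersection_comp f g w h : Prop :=
  exists a b h1 h2,
    [/\ w = lead f ++ b, w = a ++ lead g,
        (size w < size (lead f) + size (lead g))%N,
        normal_word [::] f b h1 /\ normal_word a g [::] h2 &
        h = h1 - h2].

Definition trivial_mod S w h : Prop :=
  exists n (alpha : 'I_n -> k) (a b : 'I_n -> seq X) (s e : 'I_n -> kX),
    [/\ forall i, S (s i),
        forall i, normal_word (a i) (s i) (b i) (e i),
        forall i, dlexlt (a i ++ lead (s i) ++ b i) w &
        h = \sum_(i < n) alpha i *: e i].

(* S is meant to be a nonempty set of monic Lie polynomials. *)
Definition GSbasis S : Prop :=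
  forall f g w h, S f -> S g ->
    inclusion_comp f g w h \/ intersection_comp f g w h ->
    trivial_mod S w h.

Definition decreasing_expansion S f : Prop :=
  exists n (alpha : 'I_n.+1 -> k) (a b : 'I_n.+1 -> seq X)
         (s e : 'I_n.+1 -> kX),
    let u i := a i ++ lead (s i) ++ b i in
    [/\ forall i, S (s i),
        forall i, normal_word (a i) (s i) (b i) (e i),
        f = \sum_(i < n.+1) alpha i *: e i,
        lead f = u ord0 &
        forall i j : 'I_n.+1, (i < j)%N -> dlexlt (u j) (u i)].

End Choice.

Definition Red S (t : naword X) : Prop :=
  NLSW t /\ forall a b s, S s -> wordof t <> a ++ lead s ++ b.

(* For subspaces I and L of V with I contained in L, and a family v of elements
   of L indexed by the i : J with B i: the cosets v i + I (B i) form a k-basis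
   of L / I. *)
Definition quotient_basis (V : lmodType k) (J : Type) (L I : V -> Prop)
    (B : J -> Prop) (v : J -> V) : Prop :=
  [/\ forall i, B i -> L (v i),
      (forall n (c : 'I_n -> k) (i : 'I_n -> J),
         injective i -> (forall r, B (i r)) ->
         I (\sum_(r < n) c r *: v (i r)) -> forall r, c r = 0) &
      (forall f : V, L f ->
         exists n (c : 'I_n -> k) (i : 'I_n -> J),
           (forall r, B (i r)) /\ I (f - \sum_(r < n) c r *: v (i r)))].

End LiePolynomials.

(* Main.v *)
Require Import Defs.
From mathcomp Require Import all_boot all_order all_algebra.
From mathcomp Require Import finmap monalg.
From Stdlib Require Import Classical_Prop.

(** A nonassociative Lyndon-Shirshov word evaluates to its word plus smaller
    words of the same length. By the Jacobi identity these evaluations span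
    Lie(X), so the leading word of a Lie polynomial is an ALSW. A normal word
    [asb] equals a s b plus a combination of products a' s b' whose leading word
    a' (lead s) b' is smaller than a (lead s) b, so Lie and associative
    compositions agree up to smaller terms. For a Groebner-Shirshov basis, two
    products a s b and a' s' b' with the same leading word w therefore differ by
    products below w, and the leading word of any element of the associative
    ideal of S, a fortiori of the Lie ideal, has some lead s as a factor.
    Subtracting normal words and NLSWs from the top
    gives expansions modulo S, hence (ii') and the spanning part of (iii).
    Conversely the expansion of a composition at w uses only normal words below
    w and elements of Red(S), and independence kills the latter. *)

Set Implicit Arguments.
Unset Strict Implicit.
Unset Printing Implicit Defensive.

Import Order.TTheory GRing.Theory.
Local Open Scope ring_scope.

(** * The lexicographic and deg-lex orders on words *)

Section WordOrder.
Context {d : Order.disp_t} {X : orderType d}.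
Implicit Types u v w a b c z : seq X.

Lemma lexlt_irr u : lexlt u u = false.
Proof. by elim: u => //= x u ->; rewrite ltxx eqxx. Qed.

Lemma lexlt_trans v u w : lexlt u v -> lexlt v w -> lexlt u w.
Proof.
elim: u v w => [|x u IHu] [|y v] [|z w] //= /orP[xy|/andP[/eqP-> uv]].
  case/orP=> [yz|/andP[/eqP<- _]]; first by rewrite (lt_trans xy yz).
  by rewrite xy.
case/orP=> [->//|/andP[-> vw]].
by rewrite (IHu _ _ uv vw) orbT.
Qed.

Lemma lexlt_asym u v : lexlt u v -> lexlt v u -> False.
Proof. by move=> uv vu; have := lexlt_trans uv vu; rewrite lexlt_irr. Qed.

Lemma lexlt_total u v : [\/ u = v, lexlt u v | lexlt v u].
Proof.
elim: u v => [|x u IHu] [|y v] /=;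
  try by [constructor 1 | constructor 2 | constructor 3].
case: (ltgtP x y) => [xy|xy|->] /=; try by [constructor 2 | constructor 3].
by case: (IHu v) => [->|uv|vu]; [constructor 1 | constructor 2 | constructor 3].
Qed.

Lemma lexle_refl u : lexle u u.
Proof. by rewrite /lexle eqxx. Qed.

Lemma lexltW u v : lexlt u v -> lexle u v.
Proof. by rewrite /lexle orbC => ->. Qed.

Lemma lexle_lt_trans v u w : lexle u v -> lexlt v w -> lexlt u w.
Proof. by case/orP=> [/eqP->|] //; apply: lexlt_trans. Qed.

Lemma lexlt_le_trans v u w : lexlt u v -> lexle v w -> lexlt u w.
Proof. by move=> uv /orP[/eqP<-|] //; apply: lexlt_trans. Qed.

Lemma lexle_trans v u w : lexle u v -> lexle v w -> lexle u w.
Proof. by case/orP=> [/eqP->|uv] // vw; apply/lexltW/(lexlt_le_trans uv). Qed.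

Lemma lexleNgt u v : lexle u v = ~~ lexlt v u.
Proof.
case: (lexlt_total u v) => [->|uv|vu].
- by rewrite lexle_refl lexlt_irr.
- by rewrite lexltW //; apply/esym/negP => /(lexlt_asym uv).
- rewrite vu; apply/negbTE/negP => uv.
  by have := lexle_lt_trans uv vu; rewrite lexlt_irr.
Qed.

Lemma lexle_anti u v : lexle u v -> lexle v u -> u = v.
Proof. by case/orP=> [/eqP //|uv]; rewrite lexleNgt uv. Qed.

Lemma lexlt_cat2l z u v : lexlt (z ++ u) (z ++ v) = lexlt u v.
Proof. by elim: z => //= x z ->; rewrite ltxx eqxx. Qed.

Lemma lexlt_prefix w t : t <> [::] -> lexlt (w ++ t) w.
Proof.
by move=> t0; rewrite -[X in lexlt _ X]cats0 lexlt_cat2l; case: t t0.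
Qed.

Lemma lexle_prefix w t : lexle (w ++ t) w.
Proof.
by case: t => [|x t]; [rewrite cats0 lexle_refl | apply/lexltW/lexlt_prefix].
Qed.

(** Since [u] is no longer than [v], it is not a proper extension of [v]. The comparison is thus
    decided at a letter, before the tails are reached. *)
Lemma lexlt_cat_strict u v a b :
  (size u <= size v)%N -> lexlt u v -> lexlt (u ++ a) (v ++ b).
Proof.
elim: u v => [|x u IHu] [|y v] //= uv /orP[-> //|/andP[-> ltuv]].
by rewrite IHu ?orbT.
Qed.

Lemma dlexlt_irr u : dlexlt u u = false.
Proof. by rewrite /dlexlt ltnn lexlt_irr andbF. Qed.

Lemma dlexlt_trans v u w : dlexlt u v -> dlexlt v w -> dlexlt u w.
Proof.
rewrite /dlexlt => /orP[uv|/andP[/eqP-> uv]].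
  by case/orP=> [vw|/andP[/eqP<- _]]; [rewrite (ltn_trans uv vw) | rewrite uv].
case/orP=> [->//|/andP[-> vw]].
by rewrite (lexlt_trans uv vw) orbT.
Qed.

Lemma dlexlt_asym u v : dlexlt u v -> dlexlt v u -> False.
Proof. by move=> uv vu; have := dlexlt_trans uv vu; rewrite dlexlt_irr. Qed.

Lemma dlexlt_total u v : [\/ u = v, dlexlt u v | dlexlt v u].
Proof.
rewrite /dlexlt; case: (ltngtP (size u) (size v)) => [||_] /=;
  try by [constructor 2 | constructor 3].
exact: lexlt_total.
Qed.

Lemma lexlt_dlexlt u v : size u = size v -> lexlt u v -> dlexlt u v.
Proof. by rewrite /dlexlt => -> ->; rewrite eqxx orbT. Qed.

Lemma dlexlt_cat a b u v : dlexlt u v -> dlexlt (a ++ u ++ b) (a ++ v ++ b).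
Proof.
rewrite /dlexlt !size_cat !ltn_add2l !eqn_add2l ltn_add2r eqn_add2r lexlt_cat2l.
case/orP=> [->//|/andP[/eqP uv ltuv]].
by rewrite uv eqxx lexlt_cat_strict ?uv ?orbT.
Qed.

Lemma dlexlt_catl a u v : dlexlt u v -> dlexlt (a ++ u) (a ++ v).
Proof. by move/(dlexlt_cat a [::]); rewrite !cats0. Qed.

Lemma dlexlt_catr b u v : dlexlt u v -> dlexlt (u ++ b) (v ++ b).
Proof. exact: (dlexlt_cat [::]). Qed.

Definition dlexle u v : bool := (u == v) || dlexlt u v.

Lemma dlexle_refl u : dlexle u u.
Proof. by rewrite /dlexle eqxx. Qed.

Lemma dlexle_trans v u w : dlexle u v -> dlexle v w -> dlexle u w.
Proof.
case/orP=> [/eqP->//|uv] /orP[/eqP<-|vw]; rewrite /dlexle ?uv ?orbT //.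
by rewrite (dlexlt_trans uv vw) orbT.
Qed.

Lemma dlexle_lt_trans v u w : dlexle u v -> dlexlt v w -> dlexlt u w.
Proof. by case/orP=> [/eqP->|] //; apply: dlexlt_trans. Qed.

Lemma dlexlt_le_trans v u w : dlexlt u v -> dlexle v w -> dlexlt u w.
Proof. by move=> uv /orP[/eqP<-|] //; apply: dlexlt_trans. Qed.

Lemma dlexle_anti u v : dlexle u v -> dlexle v u -> u = v.
Proof. by case/orP=> [/eqP //|uv] /orP[/eqP //|/(dlexlt_asym uv)]. Qed.

Lemma dlexle_cat u u' v v' : dlexle u u' -> dlexle v v' ->
  dlexle (u ++ v) (u' ++ v').
Proof.
move=> uu' vv'; apply: (@dlexle_trans (u' ++ v)).
  case/orP: uu' => [/eqP->|lt]; first exact: dlexle_refl.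
  by rewrite /dlexle dlexlt_catr ?orbT.
case/orP: vv' => [/eqP->|lt]; first exact: dlexle_refl.
by rewrite /dlexle dlexlt_catl ?orbT.
Qed.

Lemma dlexlt_catD u u' v v' : dlexlt u u' -> dlexle v v' ->
  dlexlt (u ++ v) (u' ++ v').
Proof.
move=> uu' vv'; apply: dlexlt_le_trans (dlexlt_catr v uu') _.
exact: dlexle_cat (dlexle_refl _) vv'.
Qed.

Lemma dlexle_ltD u u' v v' : dlexle u u' -> dlexlt v v' ->
  dlexlt (u ++ v) (u' ++ v').
Proof.
move=> uu' vv'; apply: dlexle_lt_trans (dlexlt_catl u' vv').
exact: dlexle_cat uu' (dlexle_refl _).
Qed.

Lemma dlexlt_ind (P : seq X -> Prop) :
  well_founded (fun x y : X => (x < y)%O) ->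
  (forall u, (forall v, dlexlt v u -> P v) -> P u) -> forall u, P u.
Proof.
move=> wfX step u; have [m] := ubnP (size u); elim: m u => // m IHm u.
move=> /ltnSE-le_um.
(* Words with the common prefix [p]: induction on the length of the rest [s],
   then on its first letter. *)
suff L t : forall p s, size s = t -> size (p ++ s) = size u ->
    (forall q r, size q = size p -> lexlt q p -> size (q ++ r) = size u ->
       P (q ++ r)) -> P (p ++ s).
  by apply: (L (size u) [::] u) => // -[].
elim: t => [|t IHt] p s.
  move/size0nil->; rewrite cats0 => pu IHp; apply: step => v.
  case/orP=> [vp|/andP[/eqP vp vltp]].
    by apply: IHm; apply: leq_trans le_um; rewrite -pu.
  by rewrite -[v]cats0; apply: IHp; rewrite ?cats0 // vp.
case: s => // x s [st].
elim/(well_founded_induction wfX): x s st => x IHx s st pu IHp.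
rewrite -cat_rcons; apply: IHt => //; first by rewrite cat_rcons.
move=> q r; case: (lastP q) => [|{}q y]; first by rewrite size_rcons.
rewrite !size_rcons => -[qp]; rewrite -!cats1 => ltq qr.
(* Either [q = p] and the next letter is below [x], or [q] is already below [p]; [q] above [p] at
   equal length would contradict [ltq]. *)
case: (lexlt_total q p) => [E|qltp|pltq].
- move: ltq qr; rewrite E lexlt_cat2l /= andbF orbF -catA => yx qr.
  apply: IHx => //=; move: qr pu; rewrite !size_cat /= => <- /addnI [].
  by rewrite st => ->.
- by rewrite -catA; apply: IHp => //; rewrite catA.
- case: (@lexlt_asym (p ++ [:: x]) (q ++ [:: y])) => //.
  by apply: lexlt_cat_strict => //; rewrite qp.
Qed.

End WordOrder.

(** * Associative Lyndon-Shirshov words *)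

Section LyndonWords.
Context {d : Order.disp_t} {X : orderType d}.
Implicit Types u v w p q r : seq X.

Lemma ALSW_neq0 u : ALSW u -> u <> [::].
Proof. by case. Qed.

(** The delicate case is a border, [u = v ++ w = w ++ t]. One rotation gives [v < t], the other
    [t ++ w < v ++ w], which is impossible as [v] and [t] have equal length. *)
Lemma ALSW_suffixP u :
  ALSW u <-> u <> [::] /\
    forall v w, v <> [::] -> w <> [::] -> u = v ++ w -> lexlt w u.
Proof.
split=> [][u0 Lu]; split=> // v w v0 w0 E; last first.
  by rewrite -E; apply: lexlt_trans (Lu _ _ v0 w0 E); apply: lexlt_prefix.
have rot := Lu _ _ v0 w0 E.
have szwu : (size w < size u)%N.
  by rewrite E size_cat; case: (v) v0 => //= x t _; rewrite addSn ltnS leq_addl.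
case: (lexlt_total w u) => // [Ewu|uw]; first by rewrite Ewu ltnn in szwu.
case/lexltP: (uw) => [[t t0 Et]|[p [x [y [t1 [t2 [xy Eu Ew]]]]]]].
  have rot' := Lu _ _ w0 t0 Et.
  have szvt : size v = size t.
    have := congr1 size E; rewrite Et !size_cat addnC => /addIn.
    by move->.
  rewrite -E Et lexlt_cat2l in rot; rewrite -Et E in rot'.
  have := @lexlt_cat_strict _ _ v t w w; rewrite szvt leqnn => /(_ isT rot).
  by move/(lexlt_asym rot').
suff: lexlt u (w ++ v) by rewrite E => /lexlt_asym/(_ rot).
by rewrite Eu Ew -catA lexlt_cat2l /= xy.
Qed.

Lemma ALSW_suffix u v w : ALSW u -> v <> [::] -> w <> [::] -> u = v ++ w ->
  lexlt w u.
Proof. by case/ALSW_suffixP=> _; apply. Qed.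

Lemma ALSW1 (x : X) : ALSW [:: x].
Proof. by split=> // -[|y [|z v]] [|t w]. Qed.

Lemma ALSW_factors u v : v <> [::] -> u <> [::] -> ALSW (u ++ v) -> lexlt v u.
Proof.
move=> v0 u0 Luv; apply: lexlt_trans (lexlt_prefix u v0).
exact: (ALSW_suffix Luv u0).
Qed.

(** Levi's lemma, the source of the case splits on how two factors of a word lie to each other. *)
Lemma cat_eq_cat (T : Type) (u v x z : seq T) : u ++ v = x ++ z ->
  (exists2 p, u = x ++ p & z = p ++ v) \/ (exists2 p, x = u ++ p & v = p ++ z).
Proof.
elim: u x => [|i u IHu] [|j x] /=.
- by move=> <-; left; exists [::].
- by move=> ->; right; exists (j :: x).
- by move=> <-; left; exists (i :: u).
- by case=> -> /IHu[[p -> ->]|[p -> ->]]; [left | right]; exists p.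
Qed.

Lemma ALSW_suffix_le u v w : ALSW u -> w <> [::] -> u = v ++ w -> lexle w u.
Proof.
case: v => [|x v] Lu w0 E; first by rewrite E lexle_refl.
exact/lexltW/(ALSW_suffix Lu _ w0 E).
Qed.

(** The key is [v < u ++ v], which bounds all suffixes inside [v]. A suffix that starts properly
    inside [u] is beaten by [u] at a letter. *)
Lemma ALSW_cat u v : ALSW u -> ALSW v -> lexlt v u -> ALSW (u ++ v).
Proof.
move=> Lu Lv vu; have u0 := ALSW_neq0 Lu.
have ltv : lexlt v (u ++ v).
  case/lexltP: (vu) => [[t t0 Et]|[p [x [y [t1 [t2 [xy Ev Eu]]]]]]].
    by rewrite {1}Et lexlt_cat2l; apply: (ALSW_suffix Lv u0 t0 Et).
  by rewrite Eu {1}Ev -catA lexlt_cat2l /= xy.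
apply/ALSW_suffixP; split=> [|x z x0 z0 E]; first by case: (u) u0.
case: (cat_eq_cat E) => [[[|i p] Eu Ez]|[p Ex Ev]]; first by rewrite Ez.
  rewrite Ez; apply: lexlt_cat_strict; first by rewrite Eu size_cat leq_addl.
  exact: (ALSW_suffix Lu x0 _ Eu).
exact: lexle_lt_trans (ALSW_suffix_le Lv z0 Ev) ltv.
Qed.

(** A suffix that starts inside [p] loses to [p ++ q] at a letter, so [r] has no influence. A suffix
    of [q ++ r] is at most [q ++ r], which loses in the same way. *)
Lemma ALSW_overlap p q r :
  q <> [::] -> ALSW (p ++ q) -> ALSW (q ++ r) -> ALSW (p ++ q ++ r).
Proof.
case: p => // i p q0 Lpq Lqr; set p' := i :: p in Lpq *.
have lt_strict x y : p' = x ++ y -> x <> [::] ->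
  lexlt (y ++ q ++ r) (p' ++ q ++ r).
  move=> E x0; rewrite [p' ++ _]catA [y ++ _]catA; apply: lexlt_cat_strict.
    by rewrite E !size_cat leq_add2r leq_addl.
  by apply: (ALSW_suffix Lpq x0); [case: (y) | rewrite E catA].
apply/ALSW_suffixP; split=> // x z x0 z0 E.
case: (cat_eq_cat E) => [[y Ep ->]|[y Ex Eqr]]; first exact: lt_strict Ep x0.
apply: lexle_lt_trans (ALSW_suffix_le Lqr z0 Eqr) _.
by apply: (lt_strict p' [::]); rewrite ?cats0.
Qed.

Definition max_suffix u w : Prop :=
  forall x z, x <> [::] -> z <> [::] -> u = x ++ z -> lexle z w.

Lemma max_suffix_ex u : (1 < size u)%N ->
  exists v w, [/\ v <> [::], w <> [::], u = v ++ w & max_suffix u w].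
Proof.
elim: u => // i [|j u] IHu // _.
case: u IHu => [_|l u IHu].
  exists [:: i], [:: j]; split=> // -[|i' x] z // _ z0 /(congr1 behead) /=.
  case: x => [/= <-|j' x /(congr1 behead) /=]; first exact: lexle_refl.
  by case: x => // /esym.
have [//|v [w [v0 w0 E mx]]] := IHu.
case: (boolP (lexlt w [:: j, l & u])) => [lt|]; last rewrite -lexleNgt => le.
  exists [:: i], [:: j, l & u]; split=> // -[|i' x] z // _ z0.
  move=> /(congr1 behead) /=.
  case: x => [/= <-|j' x Ez]; first exact: lexle_refl.
  by apply: lexle_trans (lexltW lt); apply: (mx (j' :: x)); rewrite ?Ez.
exists (i :: v), w; split=> //; first by rewrite E.
move=> [|i' x] z // _ z0 /(congr1 behead) /=.
by case: x => [/= <- //|j' x Ez]; apply: (mx (j' :: x)).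
Qed.

(** This is the standard factorization. If a suffix [z] of [v] were also a prefix, [v = z ++ t],
    then [z ++ w < u] would give [w < t ++ w], against the maximality of [w]. *)
Lemma ALSW_max_suffix u v w : ALSW u -> v <> [::] -> w <> [::] ->
  u = v ++ w -> max_suffix u w -> ALSW v /\ ALSW w.
Proof.
move=> Lu v0 w0 E mx; split; apply/ALSW_suffixP; split=> // x z x0 z0 Ex.
  have ltu : lexlt (z ++ w) u.
    by apply: (ALSW_suffix Lu x0); [case: (z) z0 | rewrite E Ex catA].
  case: (lexlt_total z v) => // [Ezv|].
    move/(congr1 size)/eqP: Ex; rewrite -Ezv size_cat -{1}[size z]add0n.
    by rewrite eqn_add2r eq_sym size_eq0 => /eqP/x0.
  case/lexltP=> [[t t0 Ev]|[p [i [j [t1 [t2 [ij Ev Ez]]]]]]].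
    move: ltu; rewrite E Ev -catA lexlt_cat2l.
    suff: lexle (t ++ w) w by rewrite lexleNgt => /negbTE->.
    by apply: (mx z) => //; [case: (t) t0 | rewrite E Ev catA].
  move: ltu; rewrite E Ev Ez -!catA lexlt_cat2l /= => /orP[/(lt_trans ij)|].
    by rewrite ltxx.
  by case/andP=> /eqP ji; rewrite ji ltxx in ij.
have : lexle z w by apply: (mx (v ++ x)); rewrite ?E ?Ex ?catA //; case: (v) v0.
case/orP=> // /eqP /(congr1 size)/eqP.
by rewrite Ex size_cat -{1}[size z]add0n eqn_add2r eq_sym size_eq0 => /eqP/x0.
Qed.

End LyndonWords.

(** * Bracketings of Lyndon-Shirshov words and Shirshov's lemma *)

Section LyndonTrees.
Context {d : Order.disp_t} {X : orderType d}.
Implicit Types (t l r : naword X) (a b c u v w : seq X).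

Lemma wordof_neq0 t : wordof t <> [::].
Proof. by elim: t => //= l + r _; case: (wordof l). Qed.

Lemma NLSW_ALSW t : NLSW t -> ALSW (wordof t).
Proof. by case: t => [x|l r] /= []. Qed.

Lemma NLSW_lt l r : NLSW (Node l r) -> lexlt (wordof r) (wordof l).
Proof. by case=> L _; apply: ALSW_factors L; apply: wordof_neq0. Qed.

(** By induction on [l]: a suffix reaching into [l = [l1 l2]] is at most its part inside [l], which
    is at most [l2], and the NLSW condition puts [l2] at or below [r]. *)
Lemma NLSW_max_suffix l r :
  NLSW (Node l r) -> max_suffix (wordof l ++ wordof r) (wordof r).
Proof.
elim: l r => [x|l1 IHl1 l2 _] r /= [Llr [Nl Nr le]] y z y0 z0 E.
  case: (@cat_eq_cat _ [:: x] _ _ _ E) => [[p Ex Ez]|[p Ey Er]].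
    case: y {E} y0 Ex => // y1 y _ [_ /esym].
    by case: p Ez => [-> _|? ? _]; [exact: lexle_refl | case: y].
  exact: ALSW_suffix_le (NLSW_ALSW Nr) z0 Er.
case: (cat_eq_cat E) => [[[|i p] Ex ->]|[p Ey Er]].
- exact: lexle_refl.
- apply: lexle_trans (lexle_prefix _ _) _; apply: lexle_trans le.
  by apply: (IHl1 l2 Nl y).
- exact: ALSW_suffix_le (NLSW_ALSW Nr) z0 Er.
Qed.

(** The right half of an NLSW is the largest proper suffix, so the word alone determines where to
    split. *)
Lemma NLSW_inj t t' : NLSW t -> NLSW t' -> wordof t = wordof t' -> t = t'.
Proof.
have sz l r : (size (wordof (Node l r)) == 1%N) = false.
  rewrite /= size_cat; case: (wordof l) (@wordof_neq0 l) => // ? ? _.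
  by case: (wordof r) (@wordof_neq0 r) => // ? ? _; rewrite /= addnS.
elim: t t' => [x|l IHl r IHr] [y|l' r'].
- by move=> _ _ [->].
- by move=> _ _ /(congr1 size)/esym/eqP; rewrite sz.
- by move=> _ _ /(congr1 size)/eqP; rewrite sz.
move=> N N' /= E.
have Er : wordof r = wordof r'.
  have := NLSW_max_suffix N'; rewrite -E => mx'.
  have := NLSW_max_suffix N; rewrite E => mx.
  apply: lexle_anti.
  - by apply: (mx' (wordof l)) => //; apply: wordof_neq0.
  - by apply: (mx (wordof l')) => //; apply: wordof_neq0.
have El : wordof l = wordof l'.
  move: (E); rewrite Er => /eqP; rewrite eqseq_cat ?eqxx ?andbT => [/eqP//|].
  by move/(congr1 size): E; rewrite Er !size_cat => /addIn.
by case: N N' => [_ [Nl Nr _]] [_ [Nl' Nr' _]]; congr Node;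
  [apply: IHl | apply: IHr].
Qed.

Lemma NLSW_Node l r : NLSW l -> NLSW r -> lexlt (wordof r) (wordof l) ->
  (if l is Node _ l2 then lexle (wordof l2) (wordof r) else True) ->
  NLSW (Node l r).
Proof.
by move=> Nl Nr rl le; split=> //; apply: ALSW_cat => //; apply: NLSW_ALSW.
Qed.

(** Split recursively before the largest proper suffix [w]. If the left factor were [[l1 l2]] with
    [w < l2], then [l2 ++ w] would be an ALSW, hence a proper suffix exceeding [w]. *)
Lemma NLSW_ex u : ALSW u -> exists2 t, NLSW t & wordof t = u.
Proof.
have [n] := ubnP (size u); elim: n u => // n IHn u /ltnSE-le_un Lu.
case: (ltnP 1 (size u)) => [lt1|le1]; last first.
  case: u le1 {le_un} Lu => [|x [|//]] _ Lu; first by have := ALSW_neq0 Lu.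
  by exists (Leaf x); split.
have [v [w [v0 w0 E mx]]] := max_suffix_ex lt1.
have [Lv Lw] := ALSW_max_suffix Lu v0 w0 E mx.
have sz x : x <> [::] -> (0 < size x)%N by case: x.
have [] := IHn v _ Lv.
  by apply: leq_trans le_un; rewrite E size_cat -[ltnLHS]addn0 ltn_add2l sz.
move=> l Nl El; have [] := IHn w _ Lw.
  by apply: leq_trans le_un; rewrite E size_cat -[ltnLHS]add0n ltn_add2r sz.
move=> r Nr Er; exists (Node l r); last by rewrite /= El Er.
apply: NLSW_Node => //.
  by rewrite El Er; apply: ALSW_factors; rewrite -?E.
case: l Nl El => // l1 l2 Nl El; rewrite lexleNgt Er; apply/negP => lt.
have [_ [Nl1 Nl2 _]] := Nl.
have L2w : ALSW (wordof l2 ++ w) by apply: ALSW_cat => //; apply: NLSW_ALSW.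
have := ALSW_suffix L2w (@wordof_neq0 l2) w0 erefl.
suff: lexle (wordof l2 ++ w) w by rewrite lexleNgt => /negbTE->.
apply: (mx (wordof l1)); [exact: wordof_neq0|exact: ALSW_neq0|].
by rewrite E -El catA.
Qed.

(** Descend into the half that contains [v] until [v] is a prefix of the current subtree. *)
Lemma Shirshov_fill a v b t : NLSW t -> wordof t = a ++ v ++ b ->
  ALSW v -> exists c C t',
    [/\ fill C t' = t, wordof t' = v ++ c, lword C = a & b = c ++ rword C].
Proof.
elim: t a b => [x|l IHl r IHr] a b N E Lv; have v0 := ALSW_neq0 Lv.
  case: a E => [E|y [|z a]]; last 2 first.
  - by case: v v0 {Lv}.
  - by [].
  by exists b, (@Hole _ X), (Leaf x); split=> //=; rewrite cats0.
have [_ [Nl Nr _]] := N.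
case: (a =P [::]) => [a0|a0].
  by exists b, (@Hole _ X), (Node l r); split; rewrite ?cats0 // E a0.
rewrite /= in E; case: (cat_eq_cat E) => [[p El Evb]|[p Ea Er]]; last first.
  have [c [C [t [B1 B2 B3 B4]]]] := IHr _ _ Nr Er Lv.
  by exists c, (CtxR l C), t; split=> //=; rewrite ?B1 ?B3 ?Ea.
case: (cat_eq_cat Evb) => [[q Ev Er]|[q Ep Eb]]; last first.
  rewrite Ep in El; have [c [C [t [B1 B2 B3 B4]]]] := IHl _ _ Nl El Lv.
  by exists c, (CtxL C r), t; split=> //=; rewrite ?B1 // Eb B4 catA.
case: p El Ev Evb => [|i p] El Ev Evb.
  have [c [C [t [B1 B2 B3 B4]]]] := IHr [::] _ Nr (esym Evb) Lv.
  by exists c, (CtxR l C), t; split=> //=; rewrite ?B1 ?B3 ?El ?cats0.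
case: q Ev Er => [|j q] Ev Er.
  rewrite cats0 in Ev; rewrite -Ev -[v]cats0 in El.
  have [c [C [t [B1 B2 B3 B4]]]] := IHl _ _ Nl El Lv.
  by exists c, (CtxL C r), t; split=> //=; rewrite ?B1 // catA -B4 Er.
(* [v] meets both halves, so [v ++ b] is an ALSW, hence larger than its suffix
   [wordof r], against the maximality of [wordof r]. *)
have Lvb : ALSW (v ++ b).
  rewrite Ev -catA; apply: ALSW_overlap; rewrite -?Ev -?Er //.
  exact: NLSW_ALSW.
have := NLSW_max_suffix N a0 (ALSW_neq0 Lvb) E; rewrite lexleNgt.
have p0 : i :: p <> [::] by [].
by rewrite (ALSW_suffix Lvb p0 (@wordof_neq0 r) Evb).
Qed.

Lemma Shirshov_bracketed_at a v b : ALSW (a ++ v ++ b) -> ALSW v ->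
  exists c C t, bracketed_at a v b c C t.
Proof.
move=> Lu Lv; have [t Nt Et] := NLSW_ex Lu.
have [c [C [t' [F1 F2 F3 F4]]]] := Shirshov_fill Nt Et Lv.
by exists c, C, t'; split; rewrite ?F1.
Qed.

(** The Chen-Fox-Lyndon factorization. A new first letter is merged with the factor after it as long
    as that factor is smaller; [ALSW_cat] keeps every merge an ALSW. *)
Lemma NLSW_factorization c : exists cs : seq (naword X),
  [/\ forall t i, (i < size cs)%N -> NLSW (nth t cs i),
      sorted lexle (map wordof cs) & flatten (map wordof cs) = c].
Proof.
elim: c => [|x c [cs [Ncs Scs <-]]]; first by exists [::].
rewrite -cat1s; have : NLSW (Leaf x) by split; first exact: ALSW1.
rewrite -[[:: x]]/(wordof (Leaf x)).
elim: cs (Leaf x) Ncs Scs {c} => [|r cs IHcs] l Ncs Scs Nl.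
  by exists [:: l]; split=> // t [].
case: (boolP (lexle (wordof l) (wordof r))) => [le|].
  exists [:: l, r & cs]; split=> /= [t [//|i]||//]; first exact: Ncs.
  by rewrite le.
rewrite lexleNgt negbK => rl; have Nr : NLSW r := Ncs l 0%N isT.
have [t Nt Et] := NLSW_ex (ALSW_cat (NLSW_ALSW Nl) (NLSW_ALSW Nr) rl).
have [||cs' [N' S' E']] := IHcs t _ _ Nt.
- by move=> t' i; apply: (Ncs t' i.+1).
- exact: path_sorted Scs.
- by exists cs'; split=> //; rewrite E' Et -catA.
Qed.

Lemma rnlsw_ctx_ex phi a b v : shirshov_choice phi ->
  ALSW v -> ALSW (a ++ v ++ b) -> exists K, rnlsw_ctx phi a v b K.
Proof.
move=> hphi Lv Lu.
have [C [t' B]] := hphi a v b Lv Lu (Shirshov_bracketed_at Lu Lv).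
have [cs [Ncs Scs Fcs]] := NLSW_factorization (phi a v b).
exists (ctxcomp C (foldl (@CtxL _ X) (@Hole _ X) cs)); split=> //.
by exists C, t', cs; split=> // i; apply: Ncs.
Qed.

End LyndonTrees.

(** * Linear spans *)

Section Span.
Context {k : fieldType} {V : lmodType k}.
Implicit Types (B : V -> Prop) (c : k) (e f g : V).

(** Finite linear combinations in inductive form, so that induction replaces indexed sums;
    [lspan_sumP] converts back. *)
Inductive lspan B : V -> Prop :=
| lspan0 : lspan B 0
| lspan_cons c e f : B e -> lspan B f -> lspan B (c *: e + f).

Lemma lspan_in B e : B e -> lspan B e.
Proof.
by move=> Be; rewrite -[e]addr0 -[e]scale1r; apply: lspan_cons => //;
  apply: lspan0.
Qed.

Lemma lspan_sub B B' f : (forall e, B e -> lspan B' e) -> lspan B f ->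
  lspan B' f.
Proof.
move=> sub; elim=> [|c e {}f /sub Be _ IH]; first exact: lspan0.
elim: Be => [|c' e' g Be' _ IHg]; first by rewrite scaler0 add0r.
by rewrite scalerDr scalerA -addrA; apply: lspan_cons.
Qed.

Lemma lspanD B f g : lspan B f -> lspan B g -> lspan B (f + g).
Proof.
move=> Bf Bg; elim: Bf => [|c e {}f Be _ IH]; first by rewrite add0r.
by rewrite -addrA; apply: lspan_cons.
Qed.

Lemma lspanZ B c f : lspan B f -> lspan B (c *: f).
Proof.
elim=> [|c' e {}f Be _ IH]; first by rewrite scaler0; apply: lspan0.
by rewrite scalerDr scalerA; apply: lspan_cons.
Qed.

Lemma lspanN B f : lspan B f -> lspan B (- f).
Proof. by rewrite -scaleN1r; apply: lspanZ. Qed.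

Lemma lspanB B f g : lspan B f -> lspan B g -> lspan B (f - g).
Proof. by move=> Bf /lspanN; apply: lspanD. Qed.

Lemma lspanBC B f g : lspan B (f - g) -> lspan B (g - f).
Proof. by move/lspanN; rewrite opprB. Qed.

Lemma lspan_trans B f g h : lspan B (f - g) -> lspan B (g - h) ->
  lspan B (f - h).
Proof. by move=> fg /(lspanD fg); rewrite subrKA. Qed.

Lemma lspan_sum B n (alpha : 'I_n -> k) (e : 'I_n -> V) :
  (forall i, lspan B (e i)) -> lspan B (\sum_i alpha i *: e i).
Proof.
move=> Be; apply: big_ind => [|x y|i _]; first exact: lspan0.
- exact: lspanD.
- exact: lspanZ.
Qed.

Lemma lspan_sumP B f : lspan B f ->
  exists n (alpha : 'I_n -> k) (e : 'I_n -> V),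
  (forall i, B (e i)) /\ f = \sum_i alpha i *: e i.
Proof.
elim=> [|c e {}f Be _ [n [alpha [e' [Be' ->]]]]].
  by exists 0%N, (fun=> 0), (fun=> 0); split=> [[]//|]; rewrite big_ord0.
exists n.+1, (fun i => oapp alpha c (unlift ord0 i)),
  (fun i => oapp e' e (unlift ord0 i)); split=> [i|].
  by case: unliftP => [j|] _ /=.
rewrite big_ord_recl unlift_none /=; congr (_ + _).
by apply: eq_bigr => i _; rewrite liftK.
Qed.

End Span.

Section SpanBilinear.
Context {k : fieldType} {V : lmodType k} (op : V -> V -> V).
Hypotheses (opDl : forall x y z, op (x + y) z = op x z + op y z)
  (opDr : forall x y z, op z (x + y) = op z x + op z y)
  (opZl : forall c x y, op (c *: x) y = c *: op x y)
  (opZr : forall c x y, op x (c *: y) = c *: op x y).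

Lemma lspan_bilinear (B1 B2 B : V -> Prop) f g :
  (forall e1 e2, B1 e1 -> B2 e2 -> lspan B (op e1 e2)) ->
  lspan B1 f -> lspan B2 g -> lspan B (op f g).
Proof.
move=> H; elim=> [|c e {}f B1e _ IHf] Bg.
  (* Here [op 0 g = 0] follows by writing 0 as [0 *: 0] and pulling the scalar out. *)
  by rewrite -(scale0r (0 : V)) opZl scale0r; apply: lspan0.
rewrite opDl opZl; apply: lspanD (IHf Bg); apply: lspanZ.
elim: Bg => [|c' e' g' B2e _ IHg].
  by rewrite -(scale0r (0 : V)) opZr scale0r; apply: lspan0.
by rewrite opDr opZr; apply: lspanD IHg; apply: lspanZ; apply: H.
Qed.

End SpanBilinear.

(** * The free algebra and its commutator bracket *)

Lemma commutator_jacobi (R : pzRingType) (x y z : R) :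
  (x * y - y * x) * z - z * (x * y - y * x) =
  ((x * z - z * x) * y - y * (x * z - z * x)) +
  (x * (y * z - z * y) - (y * z - z * y) * x).
Proof.
rewrite !mulrBl !mulrBr !mulrA !opprB !addrA.
(* The permutation puts the four surviving terms first, then the cancelling pairs in [x * z * y] and
   [y * z * x]. *)
by rewrite [RHS](ACl (5*4*7*2*1*6*3*8)) /= !addrK.
Qed.

Section FreeAlgebra.
Context {k : fieldType} {d : Order.disp_t} {X : orderType d}.
Local Notation kX := {malg k[{fmonom X}]}.
Implicit Types (f g h s x y : kX) (a b u v w p q r : seq X).

Definition mon w : kX := << FMonom w >>.

Lemma monM u v : mon u * mon v = mon (u ++ v).
Proof.
rewrite /mon malgM_def fgmulUU mulr1.
by rewrite -[FMonom (u ++ v)]/(FMonom (FMonom u ++ FMonom v)) -fmmulE.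
Qed.

Lemma mon0 : mon [::] = 1.
Proof. by rewrite /mon -fmoneE. Qed.

Lemma genE z : gen z = mon [:: z] :> kX.
Proof. by rewrite /gen fmuE. Qed.

Lemma mcoeff_mon u v : mcoeff (FMonom u) (mon v) = (v == u)%:R.
Proof. by rewrite mcoeffU fmP. Qed.

Lemma malg_scalerAr (c : k) f g : f * (c *: g) = c *: (f * g).
Proof.
apply/malgP => m.
(* The support of [c *: g] may be smaller than that of [g]; expanding over the larger one makes the
   two sums match. *)
apply: etrans (mcoeffMlw m (fsubset_refl _) (msuppZ_le c g)) _.
rewrite mcoeffZ mcoeffMl big_distrr.
apply: eq_bigr => m1 _ /=; rewrite big_distrr; apply: eq_bigr => m2 _ /=.
by rewrite mcoeffZ mulrCA mulrnAr.
Qed.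

Lemma lie_brDl f g h : lie_br (f + g) h = lie_br f h + lie_br g h.
Proof. by rewrite /lie_br mulrDl mulrDr opprD addrACA. Qed.

Lemma lie_brDr f g h : lie_br h (f + g) = lie_br h f + lie_br h g.
Proof. by rewrite /lie_br mulrDl mulrDr opprD addrACA. Qed.

Lemma lie_brZl (c : k) f g : lie_br (c *: f) g = c *: lie_br f g.
Proof. by rewrite /lie_br -scalerAl malg_scalerAr -scalerBr. Qed.

Lemma lie_brZr (c : k) f g : lie_br f (c *: g) = c *: lie_br f g.
Proof. by rewrite /lie_br -scalerAl malg_scalerAr -scalerBr. Qed.

Lemma lie_brC f g : lie_br f g = - lie_br g f.
Proof. by rewrite /lie_br opprB. Qed.

Lemma lie_brxx f : lie_br f f = 0.
Proof. by rewrite /lie_br subrr. Qed.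

Lemma lie_jacobi f g h :
  lie_br (lie_br f g) h = lie_br (lie_br f h) g + lie_br f (lie_br g h).
Proof. exact: commutator_jacobi. Qed.

Lemma lspan_mul (B1 B2 B : kX -> Prop) f g :
  (forall e1 e2, B1 e1 -> B2 e2 -> lspan B (e1 * e2)) ->
  lspan B1 f -> lspan B2 g -> lspan B (f * g).
Proof.
apply: lspan_bilinear => *; rewrite ?mulrDl ?mulrDr //;
  last exact: malg_scalerAr.
by rewrite scalerAl.
Qed.

Lemma lspan_lie_br (B1 B2 B : kX -> Prop) f g :
  (forall e1 e2, B1 e1 -> B2 e2 -> lspan B (lie_br e1 e2)) ->
  lspan B1 f -> lspan B2 g -> lspan B (lie_br f g).
Proof.
apply: lspan_bilinear.
- exact: lie_brDl.
- by move=> *; apply: lie_brDr.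
- exact: lie_brZl.
- exact: lie_brZr.
Qed.

End FreeAlgebra.

(** * Leading words, and families indexed by leading words *)

Section LeadingWords.
Context {k : fieldType} {d : Order.disp_t} {X : orderType d}.
Local Notation kX := {malg k[{fmonom X}]}.
Implicit Types (f g h s x y : kX) (a b u v w p q r : seq X) (P : seq X -> Prop).

Definition words P (e : kX) := exists2 u, P u & e = mon u.

Lemma wordsP P f :
  lspan (words P) f <-> forall u, mcoeff (FMonom u) f != 0 -> P u.
Proof.
split=> [|H].
  elim=> [u|c e {}f [v Pv ->] _ IH u]; first by rewrite mcoeff0 eqxx.
  rewrite mcoeffD mcoeffZ mcoeff_mon.
  by case: (v =P u) => [<- //|_]; rewrite mulr0 add0r; apply: IH.
rewrite [f]monalgE big_seq; apply: big_ind => [|x y|m mf]; first exact: lspan0.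
  exact: lspanD.
have -> : << f@_m *g m >> = f@_m *: (mon m : kX).
  apply/malgP => m'; rewrite mcoeffZ !mcoeffU fmK.
  by rewrite mulr_natr.
apply: lspanZ; apply: lspan_in; exists (m : seq X) => //.
by apply: H; rewrite fmK mcoeff_neq0.
Qed.

Lemma words_sub P P' f : (forall u, P u -> P' u) ->
  lspan (words P) f -> lspan (words P') f.
Proof. by move=> sub /wordsP Pf; apply/wordsP => u /Pf/sub. Qed.

Lemma lead_ge f u : mcoeff (FMonom u) f != 0 -> dlexle u (lead f).
Proof.
suff ge (s : seq {fmonom X}) m : m \in s ->
    dlexle m (\big[dlexmax/[::]]_(j <- s) (j : seq X)).
  by rewrite mcoeff_neq0 => /(ge (enum_fset (msupp f))).
elim: s => // m' s IHs.
rewrite big_cons inE /dlexmax => /orP[/eqP->|/IHs le]; case: ifP => // lt.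
- by rewrite /dlexle lt orbT.
- by rewrite /dlexle eqxx.
- case: (dlexlt_total m' (\big[dlexmax/[::]]_(j <- s) j)) => [->|/idPn|lt'] //.
    by rewrite lt.
  by apply: dlexle_trans le _; rewrite /dlexle lt' orbT.
Qed.

Lemma lead_neq0 f : f != 0 -> mcoeff (FMonom (lead f)) f != 0.
Proof.
move=> f0; have [m mf] : exists m, m \in msupp f.
  by apply/fset0Pn; rewrite msupp_eq0.
have in_s (s : seq {fmonom X}) :
    let M := \big[dlexmax/[::]]_(m <- s) (m : seq X) in
    M = [::] \/ FMonom M \in s.
  elim: s => [|m' s]; rewrite ?big_nil ?big_cons /=; first by left.
  rewrite /dlexmax inE; case: ifP => [_ [->|->]|_ _]; [by left | |].
  - by right; rewrite orbT.
  - by right; rewrite fmK eqxx.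
rewrite mcoeff_neq0; case: (in_s (enum_fset (msupp f))) => [E|//].
(* If the maximum is the default [[::]], every word of the support is at most [[::]], so [m] is
   [[::]] and the default does occur in [f]. *)
have : dlexle m (lead f) by apply: lead_ge; rewrite fmK mcoeff_neq0.
rewrite /lead E /dlexle /dlexlt.
by case Em: (m : seq X) => [|//] _; rewrite -Em fmK.
Qed.

Lemma lead_eq w f : mcoeff (FMonom w) f != 0 -> lspan (words (dlexle^~ w)) f ->
  lead f = w.
Proof.
move=> fw /wordsP le; apply: dlexle_anti (lead_ge fw).
by apply/le/lead_neq0; apply: contraNneq fw => ->; rewrite mcoeff0.
Qed.

Definition monic_at w f := lspan (words (dlexlt^~ w)) (f - mon w).

Lemma monic_at_lead f : dl_monic f -> monic_at (lead f) f.
Proof.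
move=> f1; apply/wordsP => u; rewrite mcoeffB mcoeff_mon.
case: (lead f =P u) => [<-|ne]; first by rewrite f1 subrr eqxx.
by rewrite subr0 => /lead_ge/orP[/eqP/esym|].
Qed.

Lemma monic_at_le w f : monic_at w f -> lspan (words (dlexle^~ w)) f.
Proof.
move=> fw; rewrite -[f](subrK (mon w)); apply: lspanD.
  by apply: words_sub fw => u lt; rewrite /dlexle lt orbT.
by apply: lspan_in; exists w; rewrite // /dlexle eqxx.
Qed.

Lemma monic_at_coef w f g (c : k) : monic_at w f ->
  lspan (words (dlexlt^~ w)) (g - c *: f) -> mcoeff (FMonom w) g = c.
Proof.
move=> fw gf; have {}fw : mcoeff (FMonom w) f = 1.
  apply/eqP; rewrite -subr_eq0; apply: contraT; have := (wordsP _ _).1 fw w.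
  by rewrite mcoeffB mcoeff_mon eqxx dlexlt_irr => /[apply].
apply/eqP; rewrite -subr_eq0; apply: contraT; have := (wordsP _ _).1 gf w.
by rewrite mcoeffB mcoeffZ fw mulr1 dlexlt_irr => /[apply].
Qed.

Lemma lead_lt w f : lspan (words (dlexlt^~ w)) f -> f != 0 -> dlexlt (lead f) w.
Proof. by move=> /wordsP lt /lead_neq0/lt. Qed.

Lemma below_lead f : lspan (words (dlexle^~ (lead f))) f.
Proof. by apply/wordsP => u /lead_ge. Qed.

(** The elimination step of all later reductions: the coefficients at [lead f] cancel and no larger
    word occurs. *)
Lemma sub_lead g f : monic_at (lead f) g ->
  lspan (words (dlexlt^~ (lead f))) (f - mcoeff (FMonom (lead f)) f *: g).
Proof.
move=> gf; apply/wordsP => u nz.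
have : dlexle u (lead f).
  move: u nz; apply/wordsP; apply: lspanB (below_lead f) _.
  exact/lspanZ/monic_at_le.
case/orP=> // /eqP Eu; move: nz.
rewrite mcoeffB mcoeffZ Eu (monic_at_coef (g := g) (c := 1) gf).
  by rewrite mulr1 subrr eqxx.
by rewrite scale1r subrr; apply: lspan0.
Qed.

(* [E e w] says that [e] is a member of the family with leading word [w]. *)
Definition family_below (E : kX -> seq X -> Prop) P (e : kX) :=
  exists2 u, E e u & P u.

Lemma family_sub E P P' f : (forall u, P u -> P' u) ->
  lspan (family_below E P) f -> lspan (family_below E P') f.
Proof.
by move=> sub; apply: lspan_sub => e [u Eu /sub Pu]; apply: lspan_in; exists u.
Qed.

Section Family.
Variable E : kX -> seq X -> Prop.
Hypothesis E_monic : forall e w, E e w -> monic_at w e.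

Lemma family_words P f : (forall u v, dlexlt u v -> P v -> P u) ->
  lspan (family_below E P) f -> lspan (words P) f.
Proof.
move=> down; apply: lspan_sub => e [u /E_monic/monic_at_le Eu Pu].
by apply: words_sub Eu => v /orP[/eqP->//|/down]; apply.
Qed.

Lemma family_max P f : lspan (family_below E P) f ->
  f = 0 \/ exists2 w, P w & lspan (family_below E (dlexle^~ w)) f.
Proof.
elim=> [|c e {}f [u Eu Pu] _ IH]; [by left | right].
have ce w : dlexle u w -> lspan (family_below E (dlexle^~ w)) (c *: e).
  by move=> uw; apply/lspanZ/lspan_in; exists u.
case: IH => [->|[w Pw Sw]].
  by exists u; rewrite ?addr0 //; apply/ce/dlexle_refl.
case: (dlexlt_total u w) => [uw|uw|wu].
- by exists w => //; apply: lspanD Sw; apply: ce; rewrite uw dlexle_refl.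
- by exists w => //; apply: lspanD Sw; apply: ce; rewrite /dlexle uw orbT.
- exists u => //; apply: lspanD (ce u (dlexle_refl u)) _.
  apply: family_sub Sw => v.
  by move=> /dlexle_lt_trans/(_ wu); rewrite /dlexle orbC => ->.
Qed.

(** For NLSWs this is uniqueness of the bracketing; for the products [a s b] it is what the
    Groebner-Shirshov condition provides. *)
Hypothesis E_coherent : forall e e' w, E e w -> E e' w ->
  lspan (family_below E (dlexlt^~ w)) (e - e').

Lemma family_top w f : lspan (family_below E (dlexle^~ w)) f ->
  lspan (family_below E (dlexlt^~ w)) f \/
  exists c e, E e w /\ lspan (family_below E (dlexlt^~ w)) (f - c *: e).
Proof.
elim=> [|c e {}f [u Eu /orP[/eqP uw|uw]] _ IH]; first by left; apply: lspan0.
  subst u; right; case: IH => [IH|[c' [e' [Ee' IH]]]].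
    by exists c, e; rewrite addrC addKr.
  exists (c + c'), e'; split; first exact: Ee'.
  rewrite scalerDl opprD addrACA -(scalerBr c e e'); apply: lspanD IH.
  exact/lspanZ/E_coherent.
have Bce : lspan (family_below E (dlexlt^~ w)) (c *: e).
  by apply/lspanZ/lspan_in; exists u.
case: IH => [IH|[c' [e' [Ee' IH]]]]; first by left; apply: lspanD.
by right; exists c', e'; split=> //; rewrite -addrA; apply: lspanD.
Qed.

(* In a combination of the family whose top words cancel, coherence rewrites
   the top part by strictly smaller members; well-foundedness ends this. *)
Lemma lead_family P f : well_founded (fun x y : X => (x < y)%O) ->
  lspan (family_below E P) f -> f != 0 -> exists e, E e (lead f).
Proof.
move=> wfX /family_max[->|[w _]]; first by rewrite eqxx.
move: w f; apply: (dlexlt_ind wfX) => w IH f Sf f0.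
have low : lspan (family_below E (dlexlt^~ w)) f -> exists e, E e (lead f).
  case/family_max=> [f00|[v vw Sv]]; first by rewrite f00 eqxx in f0.
  exact: IH Sv f0.
case: (family_top Sf) => // -[c [e [Ee Sfe]]].
have [c0|c0] := eqVneq c 0.
  by apply: low; rewrite c0 scale0r subr0 in Sfe.
exists e; have -> // : lead f = w; apply: lead_eq.
  rewrite (monic_at_coef (E_monic Ee) (c := c)) //.
  by apply: family_words Sfe => u v; apply: dlexlt_trans.
apply: family_words Sf => u v uv vw.
by have := dlexlt_le_trans uv vw; rewrite /dlexle orbC => ->.
Qed.

End Family.
End LeadingWords.

(** * Normal words compared with associative products *)

Lemma commutator_telescope (R : pzRingType) (x y p q : R) :
  x * y - y * x - p * q = (x - p) * y + p * (y - q) - y * x.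
Proof. by rewrite mulrBl mulrBr subrKA addrAC. Qed.

Section NormalWords.
Context {k : fieldType} {d : Order.disp_t} {X : orderType d}.
Local Notation kX := {malg k[{fmonom X}]}.
Implicit Types (f g h s x y : kX) (a b c u v w : seq X) (P Q R : seq X -> Prop).
Implicit Types (l r t : naword X) (S : kX -> Prop).

Lemma words_mul P Q R f g : (forall u v, P u -> Q v -> R (u ++ v)) ->
  lspan (words P) f -> lspan (words Q) g -> lspan (words R) (f * g).
Proof.
move=> PQ; apply: lspan_mul => _ _ [u Pu ->] [v Qv ->].
by rewrite monM; apply: lspan_in; exists (u ++ v); first exact: PQ.
Qed.

Lemma words_mon u : lspan (words (dlexle^~ u)) (mon u : kX).
Proof. by apply: lspan_in; exists u; first exact: dlexle_refl. Qed.

Lemma lexlt_catC u v : lexlt (v ++ u) (u ++ v) -> dlexlt (v ++ u) (u ++ v).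
Proof. by move=> lt; apply: lexlt_dlexlt; rewrite // !size_cat addnC. Qed.

(** The error is [(f - u) g + u (g - v) - g f]. The first two terms are below [u ++ v] factor by
    factor, the last because [v ++ u] is. *)
Lemma monic_at_br u v f g : monic_at u f -> monic_at v g ->
  lexlt (v ++ u) (u ++ v) -> monic_at (u ++ v) (lie_br f g).
Proof.
move=> fu gv /lexlt_catC lt.
rewrite /monic_at -monM /lie_br commutator_telescope.
apply: lspanB; first apply: lspanD.
- by apply: words_mul fu (monic_at_le gv) => p q; apply: dlexlt_catD.
- by apply: words_mul (words_mon u) gv => p q; apply: dlexle_ltD.
- apply: words_mul (monic_at_le gv) (monic_at_le fu) => p q pv qu.
  by apply: dlexle_lt_trans lt; apply: dlexle_cat.
Qed.

Lemma monic_at_naeval t : NLSW t -> monic_at (wordof t) (naeval t : kX).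
Proof.
elim: t => [x|l IHl r IHr] N /=.
  by rewrite /monic_at genE subrr; apply: lspan0.
have [L [/IHl Ml /IHr Mr _]] := N; apply: monic_at_br Ml Mr _.
case: L => _; apply=> //; exact: wordof_neq0.
Qed.

(** The products spanning the associative ideal of [S], each tagged with the word that leads it when
    [s] is monic. *)
Definition sandwich S (e : kX) w := exists s a b,
  [/\ S s, e = mon a * s * mon b & w = a ++ lead s ++ b].

Lemma sandwich_mulr S P Q R f g : (forall u v, P u -> Q v -> R (u ++ v)) ->
  lspan (family_below (sandwich S) P) f -> lspan (words Q) g ->
  lspan (family_below (sandwich S) R) (f * g).
Proof.
move=> PQ; apply: lspan_mul => _ _ [_ [s [a [b [Ss -> ->]]]] Pu] [v Qv ->].
apply: lspan_in; exists ((a ++ lead s ++ b) ++ v); last exact: PQ.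
exists s, a, (b ++ v); split; [exact: Ss | | by rewrite -!catA].
by rewrite -(monM b); apply/esym/mulrA.
Qed.

Lemma sandwich_mull S P Q R f g : (forall u v, P u -> Q v -> R (v ++ u)) ->
  lspan (family_below (sandwich S) P) f -> lspan (words Q) g ->
  lspan (family_below (sandwich S) R) (g * f).
Proof.
move=> PQ Pf Qg; apply: lspan_mul Qg Pf.
move=> _ _ [v Qv ->] [_ [s [a [b [Ss -> ->]]]] Pu].
apply: lspan_in; exists (v ++ (a ++ lead s ++ b)); last exact: PQ.
exists s, (v ++ a), b; split; [exact: Ss | | by rewrite -!catA].
by rewrite -(monM v) !mulrA.
Qed.

Lemma sandwich_in S P s a b : S s -> P (a ++ lead s ++ b) ->
  lspan (family_below (sandwich S) P) (mon a * s * mon b).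
Proof.
by move=> Ss Pw; apply: lspan_in; exists (a ++ lead s ++ b);
  first by exists s, a, b.
Qed.

Lemma sandwich_self S P s : S s -> P (lead s) ->
  lspan (family_below (sandwich S) P) s.
Proof.
move=> Ss Ps; have := @sandwich_in S P s [::] [::] Ss.
by rewrite mon0 mulr1 mul1r cats0; apply.
Qed.

Section OneElement.
Variable s : kX.
Let v := lead s.
Let I P := lspan (family_below (sandwich (eq s)) P).

(** The analogue of [monic_at] with the product [a s b] in place of a word, and smaller products of
    the same [s] in place of smaller words. *)
Definition normal_expansion a b x : Prop :=
  I (dlexlt^~ (a ++ v ++ b)) (x - mon a * s * mon b).

Lemma normal_expansion_le a b x : normal_expansion a b x ->
  I (dlexle^~ (a ++ v ++ b)) x.
Proof.
move=> nx; rewrite -[x](subrK (mon a * s * mon b)); apply: lspanD.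
  by apply: family_sub nx => u lt; rewrite /dlexle lt orbT.
by apply: sandwich_in; rewrite // dlexle_refl.
Qed.

Lemma normal_expansion_brl a b x w g : normal_expansion a b x -> monic_at w g ->
  lexlt (w ++ (a ++ v ++ b)) ((a ++ v ++ b) ++ w) ->
  normal_expansion a (b ++ w) (lie_br x g).
Proof.
move=> nx gw /lexlt_catC lt.
rewrite /normal_expansion -monM mulrA /lie_br commutator_telescope.
have -> : a ++ v ++ b ++ w = (a ++ v ++ b) ++ w by rewrite -!catA.
apply: lspanB; first apply: lspanD.
- by apply: sandwich_mulr nx (monic_at_le gw) => p q; apply: dlexlt_catD.
- apply: (@sandwich_mulr _ (dlexle^~ (a ++ v ++ b))) gw.
    by move=> p q; apply: dlexle_ltD.
  by apply: sandwich_in; rewrite // dlexle_refl.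
- apply: sandwich_mull (normal_expansion_le nx) (monic_at_le gw) => p q pv qr.
  by apply: dlexle_lt_trans lt; apply: dlexle_cat.
Qed.

Lemma normal_expansion_brr a b x w g : normal_expansion a b x -> monic_at w g ->
  lexlt ((a ++ v ++ b) ++ w) (w ++ (a ++ v ++ b)) ->
  normal_expansion (w ++ a) b (lie_br g x).
Proof.
move=> nx gw /lexlt_catC lt.
rewrite /normal_expansion -[(w ++ a) ++ v ++ b]catA.
have -> : mon (w ++ a) * s * mon b = mon w * (mon a * s * mon b).
  by rewrite -monM !mulrA.
rewrite /lie_br commutator_telescope; apply: lspanB; first apply: lspanD.
- apply: sandwich_mull (normal_expansion_le nx) gw => p q pv qw.
  exact: dlexlt_catD.
- apply: sandwich_mull nx (words_mon w) => p q pv qw.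
  exact: dlexle_ltD.
- apply: sandwich_mulr (normal_expansion_le nx) (monic_at_le gw) => p q pv qw.
  by apply: dlexle_lt_trans lt; apply: dlexle_cat.
Qed.

Lemma wordof_fill (C : nactx X) t :
  wordof (fill C t) = lword C ++ wordof t ++ rword C.
Proof.
elim: C => [|C IH r|l C IH] /=; first by rewrite cats0.
- by rewrite IH -!catA.
- by rewrite IH -!catA.
Qed.

Lemma NLSW_fill (C : nactx X) t : NLSW (fill C t) -> NLSW t.
Proof. by elim: C => //= [C IH r|l C IH] [_ [N1 N2 _]]; apply: IH. Qed.

(** Each bracket around the hole spans an ALSW, so exchanging its two halves gives a smaller word,
    as the bracketing steps require. *)
Lemma NLSW_fill_expansion (C : nactx X) t c x : NLSW (fill C t) ->
  wordof t = v ++ c -> normal_expansion [::] c x ->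
  normal_expansion (lword C) (c ++ rword C) (ctxeval C x).
Proof.
move=> N Et nx; elim: C N => [|C IH r|l C IH] /=; first by rewrite cats0.
  move=> [[_ L] [NC Nr _]]; rewrite catA.
  have Ew := wordof_fill C t; rewrite Et -catA in Ew.
  apply: normal_expansion_brl (IH NC) (monic_at_naeval Nr) _.
  by rewrite -Ew; apply: L => //; apply: wordof_neq0.
move=> [[_ L] [Nl NC _]].
have Ew := wordof_fill C t; rewrite Et -catA in Ew.
apply: normal_expansion_brr (IH NC) (monic_at_naeval Nl) _.
by rewrite -Ew; apply: L => //; apply: wordof_neq0.
Qed.

Lemma sorted_flatten_last r (cs : seq (naword X)) :
  path lexle (wordof r) (map wordof cs) -> exists2 u,
    wordof r ++ flatten (map wordof cs) = u ++ wordof (last r cs) &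
    lexle (wordof r) (wordof (last r cs)).
Proof.
elim: cs r => [|r' cs IH] r /=.
  by exists [::]; rewrite ?cats0 // lexle_refl.
case/andP=> rr' /IH[u -> le]; exists (wordof r ++ u); first by rewrite catA.
exact: lexle_trans le.
Qed.

(* The last factor is a suffix of the whole ALSW, hence below its prefix
   [v ++ c]; the first factor is at most the last one. So every prefix
   v c_1 ... c_i is again an ALSW. *)
Lemma foldl_br_expansion (cs : seq (naword X)) c x :
  ALSW (v ++ c) -> v <> [::] ->
  (forall t i, (i < size cs)%N -> NLSW (nth t cs i)) ->
  sorted lexle (map wordof cs) -> ALSW (v ++ c ++ flatten (map wordof cs)) ->
  normal_expansion [::] c x ->
  normal_expansion [::] (c ++ flatten (map wordof cs))
    (foldl (fun x r => lie_br x (naeval r)) x cs).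
Proof.
move=> + v0; elim: cs c x => [|r cs IH] c x Lvc Ncs Scs Lu nx /=;
  first by rewrite cats0.
have Nr : NLSW r := Ncs r 0%N isT.
have lt : lexlt (wordof r) (v ++ c).
  have [u Eu le] := sorted_flatten_last Scs; apply: lexle_lt_trans le _.
  move: Lu => /=; rewrite Eu !catA => Lu.
  have := ALSW_suffix Lu _ (@wordof_neq0 _ _ (last r cs)) erefl.
  move=> /(_ _)/lexlt_le_trans; apply; first by case: (v) v0.
  by rewrite -catA; apply: lexle_prefix.
have Lr := ALSW_cat Lvc (NLSW_ALSW Nr) lt.
rewrite catA; apply: IH.
- by rewrite catA.
- by move=> t i; apply: (Ncs t i.+1).
- exact: path_sorted Scs.
- by rewrite -catA.
apply: normal_expansion_brl nx (monic_at_naeval Nr) _.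
case: Lr => _; apply=> //; last exact: wordof_neq0.
by case: (v) v0.
Qed.

Lemma ctxeval_comp (C D : nactx X) x :
  ctxeval (ctxcomp C D) x = ctxeval C (ctxeval D x).
Proof. by elim: C => /= [|C -> r|l C ->]. Qed.

Lemma ctxeval_foldl (cs : seq (naword X)) (K : nactx X) x :
  ctxeval (foldl CtxL K cs) x =
  foldl (fun x r => lie_br x (naeval r)) (ctxeval K x) cs.
Proof. by elim: cs K => [|r cs IH] K //=; rewrite IH. Qed.

End OneElement.

Lemma normal_word_expansion phi a s b h :
  normal_word phi a s b h -> normal_expansion s a b h.
Proof.
case=> K [Ls Lu [C [t [cs [[N Et El Er] Ncs Scs Fcs ->]]]]] ->.
move: (phi _ _ _) => c in Et Er Fcs *.
rewrite ctxeval_comp ctxeval_foldl /= Er -El.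
(* Once the outer context is peeled off, the chain of brackets with the factors of [c] remains; it
   starts at [s] itself with no error term. *)
apply: (NLSW_fill_expansion N Et).
rewrite -Fcs -[flatten _]cat0s; apply: foldl_br_expansion => //.
- by rewrite cats0.
- exact: ALSW_neq0 Ls.
- by move=> t' i lti; rewrite (set_nth_default t) //; apply: Ncs.
- by rewrite Fcs -Et; apply: NLSW_ALSW; apply: NLSW_fill N.
- by rewrite /normal_expansion mon0 mul1r mulr1 subrr; apply: lspan0.
Qed.

End NormalWords.

(** * NLSWs span the Lie polynomials; Lie ideals *)

Lemma count_ltn (T : eqType) (p q : pred T) (z : T) (s : seq T) :
  (forall y, p y -> q y) -> z \in s -> q z -> ~~ p z ->
    (count p s < count q s)%N.
Proof.
move=> pq + qz pz; elim: s => //= y s IH; rewrite inE => /orP[/eqP<-|/IH lt].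
  by rewrite qz (negPf pz) ltnS; apply: sub_count => ?; apply: pq.
by rewrite -addnS leq_add //; case: (boolP (p y)) => // /pq->.
Qed.

Section LieSpan.
Context {k : fieldType} {d : Order.disp_t} {X : orderType d}.
Local Notation kX := {malg k[{fmonom X}]}.
Implicit Types (f g h s x y : kX) (a b c u v w : seq X) (P Q R : seq X -> Prop).
Implicit Types (l r t : naword X) (S : kX -> Prop).

Definition nlsw (e : kX) w :=
  exists t, [/\ NLSW t, e = naeval t & w = wordof t].

Lemma nlsw_monic e w : nlsw e w -> monic_at w e.
Proof. by case=> t [Nt -> ->]; apply: monic_at_naeval. Qed.

Lemma nlsw_in P t : NLSW t -> P (wordof t) ->
  lspan (family_below nlsw P) (naeval t).
Proof.
by move=> Nt Pt; apply: lspan_in; exists (wordof t); first by exists t.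
Qed.

Lemma nlsw_coherent e e' w : nlsw e w -> nlsw e' w ->
  lspan (family_below nlsw (dlexlt^~ w)) (e - e').
Proof.
case=> t [Nt -> ->] [t' [Nt' -> /(NLSW_inj Nt Nt')<-]].
by rewrite subrr; apply: lspan0.
Qed.

(** A finite list containing every word that occurs as a factor of a rearrangement of [u]. Counting
    its members above the right factor of a bracket gives a termination measure. *)
Definition subwords u :=
  [seq take i p | p <- permutations u, i <- iota 0 (size u).+1].

Lemma mem_subwords u v w : perm_eq (u ++ v) w -> v \in subwords w.
Proof.
move=> uvw; apply/allpairsP; exists (v ++ u, size v); split.
- by rewrite mem_permutations perm_catC.
- by rewrite mem_iota add0n ltnS -(perm_size uvw) size_cat leq_addl.
- by rewrite /= take_size_cat.
Qed.

(* The Jacobi identity turns [[l r] v] with [r > v] into brackets whose smaller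
   word exceeds [v]; among the finitely many rearrangements of a given word
   this stops. *)
Lemma lie_br_NLSW t1 t2 : NLSW t1 -> NLSW t2 -> lexlt (wordof t2) (wordof t1) ->
  lspan (family_below nlsw (fun w =>
    lexlt (wordof t2) w /\ perm_eq w (wordof t1 ++ wordof t2)))
    (lie_br (naeval t1) (naeval t2)).
Proof.
have [n] := ubnP (size (wordof t1 ++ wordof t2)).
elim: n t1 t2 => // n IHn t1 t2 /ltnSE.
suff: forall m W t1 t2, (size W <= n)%N ->
    (count (lexlt (wordof t2)) (subwords W) < m)%N ->
    perm_eq (wordof t1 ++ wordof t2) W -> NLSW t1 -> NLSW t2 ->
    lexlt (wordof t2) (wordof t1) ->
    lspan (family_below nlsw (fun w => lexlt (wordof t2) w /\ perm_eq w W))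
      (lie_br (naeval t1) (naeval t2)).
  by move=> H le_n N1 N2 lt; apply: (H _ _ _ _ le_n (ltnSn _)).
elim=> // m IHm W {}t1 {}t2 szW /ltnSE-le_m pW N1 N2 lt21.
set Q := fun w => _.
(* When both words exceed [wordof t2], so does the smaller one, and fewer members of [subwords W]
   lie above it: the inner induction applies. *)
have any t t' : perm_eq (wordof t ++ wordof t') W -> NLSW t -> NLSW t' ->
    lexlt (wordof t2) (wordof t) -> lexlt (wordof t2) (wordof t') ->
    lspan (family_below nlsw Q) (lie_br (naeval t) (naeval t')).
  wlog lt : t t' / lexlt (wordof t') (wordof t) => [IH|] p Nt Nt' l l'.
    case: (lexlt_total (wordof t) (wordof t')) => [/(NLSW_inj Nt Nt')->|lt|lt].
    - by rewrite lie_brxx; apply: lspan0.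
    - by rewrite lie_brC; apply/lspanN/IH; rewrite // perm_catC.
    - exact: IH.
  have lt_m : (count (lexlt (wordof t')) (subwords W) < m)%N.
    apply: leq_trans le_m; apply: (count_ltn (z := wordof t')) => //.
    - by move=> y; apply: lexlt_trans.
    - exact: mem_subwords p.
    - by rewrite lexlt_irr.
  apply: family_sub (IHm W t t' szW lt_m p Nt Nt' lt) => w [].
  by move/(lexlt_trans l').
have base : (if t1 is Node _ l2 then lexle (wordof l2) (wordof t2) else True) ->
    lspan (family_below nlsw Q) (lie_br (naeval t1) (naeval t2)).
  move=> le; have N := NLSW_Node N1 N2 lt21 le.
  apply: (nlsw_in N); split=> //=.
  by apply: (ALSW_suffix (NLSW_ALSW N) _ _ erefl); apply: wordof_neq0.
case: t1 => [x|l r] in pW N1 lt21 base *; first exact: base.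
case: (boolP (lexle (wordof r) (wordof t2))) => [/base//|];
  rewrite lexleNgt negbK => lt2r.
have [_ [Nl Nr _]] := N1; have lt2l := lexlt_trans lt2r (NLSW_lt N1).
have sz0 t : (0 < size (wordof t))%N by case: (wordof t) (@wordof_neq0 _ _ t).
have szlr : (size (wordof l) + size (wordof r) + size (wordof t2) <= n)%N.
  by rewrite -!size_cat (perm_size pW).
have [] := (IHn l t2, IHn r t2); rewrite !size_cat => IHl IHr.
(* The brackets of [l] and of [r] with [t2] are shorter, and by the outer induction they expand in
   words above [t2]; [any] then handles the outer brackets. *)
rewrite /= lie_jacobi; apply: lspanD.
  apply: (lspan_lie_br (B2 := eq (naeval r))) (lspan_in erefl); last first.
    apply: IHl => //; apply: leq_trans szlr.
    by rewrite ltn_add2r -[ltnLHS]addn0 ltn_add2l.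
  move=> _ _ [_ [t [Nt -> ->]] [lt2t pt]] <-; apply: any => //.
  apply: perm_trans pW; rewrite /= -catA.
  rewrite (perm_trans (perm_cat pt (perm_refl _))) // -catA.
  by rewrite perm_cat2l perm_catC.
apply: (lspan_lie_br (B1 := eq (naeval l))) (lspan_in erefl) _; last first.
  apply: IHr => //; apply: leq_trans szlr.
  by rewrite ltn_add2r -[ltnLHS]add0n ltn_add2r.
move=> _ _ <- [_ [t [Nt -> ->]] [lt2t pt]]; apply: any => //.
by apply: perm_trans pW; rewrite /= -catA perm_cat2l.
Qed.

Lemma lie_br_nlsw f g : lspan (family_below nlsw (fun=> True)) f ->
  lspan (family_below nlsw (fun=> True)) g ->
  lspan (family_below nlsw (fun=> True)) (lie_br f g).
Proof.
apply: lspan_lie_br => _ _ [_ [t [Nt -> _]] _] [_ [t' [Nt' -> _]] _].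
case: (lexlt_total (wordof t) (wordof t')) => [/(NLSW_inj Nt Nt')->|lt|lt].
- by rewrite lie_brxx; apply: lspan0.
- rewrite lie_brC; apply: lspanN.
  by apply: family_sub (lie_br_NLSW Nt' Nt lt) => w.
- by apply: family_sub (lie_br_NLSW Nt Nt' lt) => w.
Qed.

Lemma Lie_nlsw f : Lie f -> lspan (family_below nlsw (fun=> True)) f.
Proof.
elim=> [x||{}f g _ IHf _ IHg|c {}f _ IHf|{}f g _ IHf _ IHg].
- apply: (@nlsw_in _ (Leaf x)) => //; split=> //; exact: ALSW1.
- exact: lspan0.
- exact: lspanD.
- exact: lspanZ.
- exact: lie_br_nlsw.
Qed.

Lemma lead_Lie f : well_founded (fun x y : X => (x < y)%O) ->
  Lie f -> f != 0 -> ALSW (lead f).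
Proof.
move=> wfX /Lie_nlsw Lf f0.
have [e [t [Nt _ ->]]] := lead_family nlsw_monic nlsw_coherent wfX Lf f0.
exact: NLSW_ALSW.
Qed.

Lemma Lie_naeval t : Lie (naeval t : kX).
Proof. by elim: t => [x|l Hl r Hr] /=; [apply: Lie_gen | apply: Lie_br]. Qed.

Lemma LieB f g : Lie f -> Lie g -> Lie (f - g).
Proof.
by move=> Lf Lg; apply: Lie_add => //; rewrite -scaleN1r; apply: Lie_scale.
Qed.

Section Ideal.
Variable S : kX -> Prop.

Lemma IdLieN f : IdLie S f -> IdLie S (- f).
Proof. by rewrite -scaleN1r; apply: IdLie_scale. Qed.

Lemma IdLieB f g : IdLie S f -> IdLie S g -> IdLie S (f - g).
Proof. by move=> If /IdLieN; apply: IdLie_add. Qed.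

Lemma IdLie_brl f g : IdLie S f -> Lie g -> IdLie S (lie_br g f).
Proof. by move=> If Lg; rewrite lie_brC; apply/IdLieN/IdLie_br. Qed.

Lemma IdLie_ctxeval (C : nactx X) f : IdLie S f -> IdLie S (ctxeval C f).
Proof.
move=> If; elim: C => //= [C IH r|l C IH].
  exact: IdLie_br IH (Lie_naeval r).
exact: IdLie_brl IH (Lie_naeval l).
Qed.

Lemma IdLie_normal_word phi a s b h : S s -> normal_word phi a s b h ->
  IdLie S h.
Proof. by move=> Ss [K _ ->]; apply/IdLie_ctxeval/IdLie_gen. Qed.

Hypothesis S_Lie : forall s, S s -> Lie s.

Lemma IdLie_Lie f : IdLie S f -> Lie f.
Proof.
elim=> [s /S_Lie//||{}f g _ Lf _ Lg|c {}f _ Lf|{}f g _ Lf Lg].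
- exact: Lie_0.
- exact: Lie_add.
- exact: Lie_scale.
- exact: Lie_br.
Qed.

(** The Lie ideal lies in the associative ideal, since a bracket is a difference of a right and a
    left multiple. *)
Lemma IdLie_sandwich f : IdLie S f ->
  lspan (family_below (sandwich S) (fun=> True)) f.
Proof.
have true_words g : lspan (words (fun=> True)) g by apply/wordsP.
elim=> [s Ss||{}f g _ IHf _ IHg|c {}f _ IHf|{}f g _ IHf Lg].
- exact: sandwich_self.
- exact: lspan0.
- exact: lspanD.
- exact: lspanZ.
- apply: lspanB.
    exact: (sandwich_mulr (P := fun=> True)) IHf (true_words g).
  exact: (sandwich_mull (P := fun=> True)) IHf (true_words g).
Qed.

End Ideal.
End LieSpan.

(** * Products of elements of [S] and their normal words *)

Lemma mulrB_telescope (R : pzRingType) (x y p q : R) :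
  x * q - p * y = (x - p) * y - x * (y - q).
Proof. by rewrite mulrBl mulrBr opprB [RHS]addrC subrKA. Qed.

Lemma mulrB_factor (R : pzRingType) (a f b p g c : R) :
  a * f * b - a * p * g * c = a * (f * b - p * g * c).
Proof. by rewrite mulrBr !mulrA. Qed.

Section CompositionDiamond.
Context {k : fieldType} {d : Order.disp_t} {X : orderType d}.
Local Notation kX := {malg k[{fmonom X}]}.
Implicit Types (f g h s x y : kX) (a b c u v w p q : seq X).
Hypothesis wfX : well_founded (fun x y : X => (x < y)%O).
Variable phi : seq X -> seq X -> seq X -> seq X.
Hypothesis hphi : shirshov_choice phi.
Variable S : kX -> Prop.
Hypothesis S_Lie : forall s, S s -> Lie s.
Hypothesis S_monic : forall s, S s -> dl_monic s.

Lemma lead_S s : S s -> ALSW (lead s).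
Proof.
move=> Ss; apply: (lead_Lie wfX (S_Lie Ss)); apply/eqP => s0.
have := S_monic Ss; rewrite /dl_monic s0 mcoeff0 => /eqP.
by rewrite eq_sym oner_eq0.
Qed.

Lemma sandwich_monic e w : sandwich S e w -> monic_at w e.
Proof.
case=> s [a [b [Ss -> ->]]]; rewrite /monic_at.
have -> : mon (a ++ lead s ++ b) = mon a * mon (lead s) * mon b :> kX.
  by rewrite !monM catA.
rewrite -mulrBl -mulrBr catA; apply: words_mul _ (words_mon b).
  by move=> p q; apply: dlexlt_catD.
apply: words_mul (words_mon a) (monic_at_lead (S_monic Ss)) => p q.
exact: dlexle_ltD.
Qed.

Lemma normal_word_ex a s b : S s -> ALSW (a ++ lead s ++ b) ->
  exists h, normal_word phi a s b h.
Proof.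
move=> Ss Lw; have [K HK] := rnlsw_ctx_ex hphi (lead_S Ss) Lw.
by exists (ctxeval K s), K.
Qed.

Lemma normal_word_sandwich a s b h : S s -> normal_word phi a s b h ->
  lspan (family_below (sandwich S) (dlexlt^~ (a ++ lead s ++ b)))
    (h - mon a * s * mon b).
Proof.
move=> Ss /normal_word_expansion; apply: lspan_sub => e.
case=> _ [_ [a' [b' [<- -> ->]]]] lt.
exact: sandwich_in.
Qed.

Lemma normal_word_monic a s b h : S s -> normal_word phi a s b h ->
  monic_at (a ++ lead s ++ b) h.
Proof.
move=> Ss /(normal_word_sandwich Ss) N; rewrite /monic_at.
apply: (@lspan_trans _ _ _ _ (mon a * s * mon b)).
  by apply: family_words sandwich_monic _ _ _ N => u v; apply: dlexlt_trans.
by apply: sandwich_monic; exists s, a, b.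
Qed.

Lemma trivial_mod_sandwich w h : trivial_mod phi S w h ->
  lspan (family_below (sandwich S) (dlexlt^~ w)) h.
Proof.
case=> n [alpha [a [b [s [e [Ss Ne lt ->]]]]]]; apply: lspan_sum => i.
rewrite -[e i](subrK (mon (a i) * s i * mon (b i))); apply: lspanD.
  apply: family_sub (normal_word_sandwich (Ss i) (Ne i)) => u /dlexlt_trans.
  exact.
exact: sandwich_in.
Qed.

Lemma sandwich_catl a w h : lspan (family_below (sandwich S) (dlexlt^~ w)) h ->
  lspan (family_below (sandwich S) (dlexlt^~ (a ++ w))) (mon a * h).
Proof.
by move=> hw; apply: sandwich_mull hw (words_mon a) => u v lt le;
  apply: dlexle_ltD.
Qed.

Lemma sandwich_catr b w h : lspan (family_below (sandwich S) (dlexlt^~ w)) h ->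
  lspan (family_below (sandwich S) (dlexlt^~ (w ++ b))) (h * mon b).
Proof.
by move=> hw; apply: sandwich_mulr hw (words_mon b) => u v; apply: dlexlt_catD.
Qed.

Definition lead_divisible := forall f, IdLie S f -> f <> 0 ->
  exists s a b, S s /\ lead f = a ++ lead s ++ b.

(** * Coherence of the products over a Groebner-Shirshov basis *)

Section Coherence.
Hypothesis GS : GSbasis phi S.

(** A normal word [h] mediates: [f - h] is a composition, trivial by hypothesis, and [h] equals
    [a g b] up to smaller products. *)
Lemma inclusion_coherent f g a b : S f -> S g -> lead f = a ++ lead g ++ b ->
  lspan (family_below (sandwich S) (dlexlt^~ (lead f))) (f - mon a * g * mon b).
Proof.
move=> Sf Sg E; have Lw := lead_S Sf; rewrite E in Lw.
have [h Nh] := normal_word_ex Sg Lw.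
apply: (@lspan_trans _ _ _ _ h).
  by apply/trivial_mod_sandwich/(GS Sf Sg); left; exists a, b, h.
by rewrite E; apply: normal_word_sandwich.
Qed.

(** By [ALSW_overlap] the word [a ++ q ++ b] is an ALSW, so both normal words of the composition
    exist, and each is close to its product. *)
Lemma intersection_coherent f g a q b : S f -> S g -> q <> [::] ->
  lead f = a ++ q -> lead g = q ++ b ->
  lspan (family_below (sandwich S) (dlexlt^~ (a ++ q ++ b)))
    (f * mon b - mon a * g).
Proof.
move=> Sf Sg q0 Ef Eg.
have Lf := lead_S Sf; have Lg := lead_S Sg.
have Lw : ALSW (a ++ q ++ b) by apply: ALSW_overlap; rewrite -?Ef -?Eg.
have Wf : [::] ++ lead f ++ b = a ++ q ++ b by rewrite Ef -catA.
have Wg : a ++ lead g ++ [::] = a ++ q ++ b by rewrite Eg cats0.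
have [h1 N1] : exists h, normal_word phi [::] f b h.
  by apply: normal_word_ex; rewrite ?Wf.
have [h2 N2] : exists h, normal_word phi a g [::] h.
  by apply: normal_word_ex; rewrite ?Wg.
have := normal_word_sandwich Sf N1; rewrite Wf mon0 mul1r => /lspanBC H1.
have := normal_word_sandwich Sg N2; rewrite Wg mon0 mulr1 => H2.
apply: lspan_trans H1 _; apply: lspan_trans H2; apply: trivial_mod_sandwich.
apply: (GS Sf Sg); right; exists a, b, h1, h2; split=> //.
- by rewrite Eg.
- rewrite Ef Eg !size_cat -!addnA !ltn_add2l -[ltnLHS]add0n ltn_add2r.
  by case: (q) q0.
Qed.

(** No composition enters: with [y = a g b] and leading word [u], the difference is
    [(f - lead f) y - f (y - u)], and both terms consist of smaller products. *)
Lemma disjoint_coherent f g a b : S f -> S g ->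
  lspan (family_below (sandwich S) (dlexlt^~ (lead f ++ a ++ lead g ++ b)))
    (f * mon (a ++ lead g ++ b) - mon (lead f ++ a) * g * mon b).
Proof.
move=> Sf Sg; pose y := mon a * g * mon b.
pose u := a ++ lead g ++ b; rewrite -/u.
have -> : f * mon u - mon (lead f ++ a) * g * mon b =
    (f - mon (lead f)) * y - f * (y - mon u).
  have -> : mon (lead f ++ a) * g * mon b = mon (lead f) * y.
    by rewrite -monM !mulrA.
  exact: mulrB_telescope.
have yu : monic_at u y by apply: sandwich_monic; exists g, a, b.
apply: lspanB.
  apply: (sandwich_mull (P := dlexle^~ u)) (monic_at_lead (S_monic Sf)).
    by move=> p q pu qf; apply: dlexlt_catD.
  by apply: sandwich_in; rewrite // dlexle_refl.
apply: (sandwich_mulr (P := dlexle^~ (lead f))) yu.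
  by move=> p q; apply: dlexle_ltD.
by apply: sandwich_self; rewrite // dlexle_refl.
Qed.

Lemma suffix_coherent f g a b b' : S f -> S g ->
  lead f ++ b = a ++ lead g ++ b' ->
  lspan (family_below (sandwich S) (dlexlt^~ (lead f ++ b)))
    (f * mon b - mon a * g * mon b').
Proof.
move=> Sf Sg E; case: (cat_eq_cat E) => [[q Ef Eg]|[y -> ->]]; last first.
  exact: disjoint_coherent.
case: (cat_eq_cat Eg) => [[y Eg' ->]|[z Eq ->]]; last first.
  have Efg : lead f = a ++ lead g ++ z by rewrite Ef Eq.
  rewrite -(monM z) (mulrA (mon a * g)) -(mulrBl (mon b)).
  exact/sandwich_catr/inclusion_coherent.
(* An empty overlap means that the leading words are adjacent: the disjoint case with nothing in
   between. *)
case: q Ef Eg' {Eg} => [|i q] Ef Eg.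
  rewrite cats0 in Ef; rewrite -Ef -[y]/([::] ++ y) -Eg -[X in mon X * g]cats0.
  exact: (@disjoint_coherent f g [::] b').
have q0 : i :: q <> [::] by [].
have -> : lead f ++ y ++ b' = (a ++ (i :: q) ++ y) ++ b' by rewrite Ef -!catA.
rewrite -(monM y) (mulrA f) -(mulrBl (mon b')).
exact/sandwich_catr/intersection_coherent.
Qed.

Lemma sandwich_coherent e e' w : sandwich S e w -> sandwich S e' w ->
  lspan (family_below (sandwich S) (dlexlt^~ w)) (e - e').
Proof.
(* The factor that starts first plays the role of [f], and the common left context is multiplied
   on. *)
have main f g a p b b' : S f -> S g -> lead f ++ b = p ++ lead g ++ b' ->
    lspan (family_below (sandwich S) (dlexlt^~ (a ++ lead f ++ b)))
      (mon a * f * mon b - mon (a ++ p) * g * mon b').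
  move=> Sf Sg E.
  rewrite -(monM a) mulrB_factor.
  exact/sandwich_catl/suffix_coherent.
case=> f [a [b [Sf -> ->]]] [g [a' [b' [Sg -> E]]]].
case: (cat_eq_cat E) => [[p -> Ep]|[p -> Ep]]; last exact: main.
by apply: lspanBC; rewrite -catA -Ep; apply: main.
Qed.

Lemma GSbasis_lead : lead_divisible.
Proof.
move=> f If /eqP f0.
have [e [s [a [b [Ss _ ->]]]]] :=
  lead_family sandwich_monic sandwich_coherent wfX (IdLie_sandwich If) f0.
by exists s, a, b.
Qed.

End Coherence.

(** * Expansions in normal words and in the elements of [Red S] *)

Lemma lead_divisible_expansion f : lead_divisible -> IdLie S f -> f <> 0 ->
  decreasing_expansion phi S f.
Proof.
move=> Hdiv; move: {2}(lead f) (erefl (lead f)) => w; move: w f.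
apply: (dlexlt_ind wfX) => w IH f Ew If f0.
have [s [a [b [Ss Ef]]]] := Hdiv f If f0.
(* That [f] is a Lie polynomial makes [lead f] an ALSW, so a normal word with this leading word
   exists. *)
have Lf : ALSW (lead f).
  by apply: (lead_Lie wfX (IdLie_Lie S_Lie If)); apply/eqP.
rewrite Ef in Lf; have [h Nh] := normal_word_ex Ss Lf.
have Mh := normal_word_monic Ss Nh; rewrite -Ef in Mh.
have lt := sub_lead Mh; set c := mcoeff _ f in lt.
have [f'0|f'0] := eqVneq (f - c *: h) 0.
  exists 0%N, (fun=> c), (fun=> a), (fun=> b), (fun=> s), (fun=> h); split=> //.
    by rewrite big_ord_recl big_ord0 addr0; apply/eqP; rewrite -subr_eq0 f'0.
  by case=> [[|//] lti] [[|//] ltj].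
have If' : IdLie S (f - c *: h).
  apply: IdLieB If _; apply: IdLie_scale; exact: IdLie_normal_word Ss Nh.
have ltw := lead_lt lt f'0; rewrite Ew in ltw.
have [] := IH _ ltw _ erefl If'; first exact/eqP.
move=> n [alpha [a' [b' [s' [e [Ss' Ne Ef' lead0 dec]]]]]].
have lt_w j : dlexlt (a' j ++ lead (s' j) ++ b' j) w.
  have [->|j0] := eqVneq j ord0; first by rewrite -lead0.
  by apply: dlexlt_trans ltw; rewrite lead0; apply: dec; rewrite lt0n.
(* The new leading term goes to index 0, in front of the expansion of the remainder. *)
pose cons T (z : T) (F : 'I_n.+1 -> T) (i : 'I_n.+2) :=
  oapp F z (unlift ord0 i).
exists n.+1, (cons _ c alpha), (cons _ a a'), (cons _ b b'), (cons _ s s'),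
  (cons _ h e).
have cons0 T (z : T) F : cons T z F ord0 = z by rewrite /cons unlift_none.
have consS T (z : T) F j : cons T z F (lift ord0 j) = F j.
  by rewrite /cons liftK.
split=> [i|i|||i j].
- by case: (unliftP ord0 i) => [j|] ->; rewrite ?consS ?cons0.
- by case: (unliftP ord0 i) => [j|] ->; rewrite ?consS ?cons0.
- rewrite big_ord_recl !cons0; under eq_bigr do rewrite !consS.
  by rewrite -Ef' addrC subrK.
- by rewrite !cons0.
- case: (unliftP ord0 j) => [j'|] -> //; rewrite !consS.
  case: (unliftP ord0 i) => [i'|] ->; rewrite ?consS ?cons0; first exact: dec.
  by rewrite -Ef Ew.
Qed.

Definition normal_below w e := exists s a b,
  [/\ S s, normal_word phi a s b e & dlexlt (a ++ lead s ++ b) w].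

Lemma normal_below_IdLie w f : lspan (normal_below w) f -> IdLie S f.
Proof.
elim=> [|c e {}f [s [a [b [Ss Ne _]]]] _ If]; first exact: IdLie_0.
by apply: IdLie_add If; apply: IdLie_scale; exact: IdLie_normal_word Ss Ne.
Qed.

Lemma normal_below_trivial w f : lspan (normal_below w) f ->
  trivial_mod phi S w f.
Proof.
case/lspan_sumP=> n [alpha [e [Ne ->]]].
have /fin_all_exists[s /fin_all_exists[a /fin_all_exists[b H]]] := Ne.
by exists n, alpha, a, b, s, e; split=> // i; case: (H i).
Qed.

Lemma normal_below_le v w f : dlexlt v w -> lspan (normal_below v) f ->
  lspan (normal_below w) f.
Proof.
move=> vw; apply: lspan_sub => e [s [a [b [Ss Ne lt]]]]; apply: lspan_in.
by exists s, a, b; split=> //; apply: dlexlt_trans vw.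
Qed.

(** The top term is removed by a normal word if [lead f] contains a leading word of [S], and by an
    NLSW otherwise. The bound [w] is carried along because triviality of a composition asks for
    it. *)
Lemma Lie_reduce w f : Lie f -> lspan (words (dlexlt^~ w)) f ->
  exists n (c : 'I_n -> k) (i : 'I_n -> naword X),
    [/\ injective i, forall r, Red S (i r), forall r, dlexlt (wordof (i r)) w &
        lspan (normal_below w) (f - \sum_(r < n) c r *: naeval (i r))].
Proof.
move: w f; apply: (dlexlt_ind wfX) => w IH f Lf fw.
have [->|f0] := eqVneq f 0.
  exists 0%N, (fun=> 0), (fun i : 'I_0 => False_rect _ (notF (ltn_ord i))).
  split=> [[]//|[]//|[]//|].
  by rewrite big_ord0 subrr; apply: lspan0.
have ltw := lead_lt fw f0; have Lw := lead_Lie wfX Lf f0.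
case: (classic (exists s a b, S s /\ lead f = a ++ lead s ++ b)).
  move=> [s [a [b [Ss Ef]]]].
  have Lw' := Lw; rewrite Ef in Lw'; have [h Nh] := normal_word_ex Ss Lw'.
  have Mh := normal_word_monic Ss Nh; rewrite -Ef in Mh.
  have lt := sub_lead Mh; set c := mcoeff _ f in lt.
  have [] := IH _ ltw _ _ lt.
    apply: LieB Lf _; apply: Lie_scale; apply: IdLie_Lie S_Lie _ _.
    exact: IdLie_normal_word Ss Nh.
  move=> n [c' [i [inj Ri lti Hn]]]; exists n, c', i; split=> // [r|].
    exact: dlexlt_trans ltw.
  rewrite -[f](subrK (c *: h)) addrAC; apply: lspanD.
    exact: normal_below_le Hn.
  by apply: lspanZ; apply: lspan_in; exists s, a, b; split=> //; rewrite -Ef.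
move=> notdiv; have [t Nt Et] := NLSW_ex Lw.
have Mt : monic_at (wordof t) (naeval t : kX) := monic_at_naeval Nt.
rewrite Et in Mt.
have lt := sub_lead Mt; set c := mcoeff _ f in lt.
have [] := IH _ ltw _ _ lt.
  by apply: LieB Lf _; apply: Lie_scale; apply: Lie_naeval.
move=> n [c' [i [inj Ri lti Hn]]].
exists n.+1, (fun r => oapp c' c (unlift ord0 r)),
  (fun r => oapp i t (unlift ord0 r)).
(* The trees already found have words below [lead f], so adding [t] keeps the family injective. *)
have it r : i r <> t by move=> E; have := lti r; rewrite E Et dlexlt_irr.
split=> [r r'|r|r|].
- case: (unliftP ord0 r) => [j|] ->; case: (unliftP ord0 r') => [j'|] -> //=.
  + by move/inj->.
  + by move/it.
  + by move/esym/it.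
- case: (unliftP ord0 r) => [j|] _ /=; first exact: Ri.
  by split=> // a b s Ss; rewrite Et => E; apply: notdiv; exists s, a, b.
- case: (unliftP ord0 r) => [j|] _ /=; last by rewrite Et.
  exact: dlexlt_trans ltw.
- rewrite big_ord_recl unlift_none /=; under eq_bigr do rewrite liftK /=.
  by rewrite opprD addrA; apply: normal_below_le Hn.
Qed.

(** Distinct NLSWs have distinct words, so the largest word with a nonzero coefficient leads the
    sum; being reduced, it contains no leading word of [S]. *)
Lemma Red_independent n (c : 'I_n -> k) (i : 'I_n -> naword X) :
  lead_divisible -> injective i -> (forall r, Red S (i r)) ->
  IdLie S (\sum_(r < n) c r *: naeval (i r)) -> forall r, c r = 0.
Proof.
move=> Hdiv inj Ri; set f := \sum_r _ => If r0; apply/eqP/negPn/negP => c0.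
(* The order is reversed so that the extremum is the largest word. *)
pose ord u v := dlexle v u.
have total : total ord.
  by move=> u v; case: (dlexlt_total u v) => [->|lt|lt];
    rewrite /ord /dlexle ?eqxx ?lt ?orbT.
have ord_trans : transitive ord.
  by move=> v u w uv vw; apply: dlexle_trans vw uv.
have [r /= cr maxr] := extremumP (ord := ord) (P := fun r => c r != 0)
  (fun r => wordof (i r)) dlexle_refl ord_trans total c0.
have N r' : NLSW (i r') by case: (Ri r').
have Mr : monic_at _ (naeval (i r) : kX) := monic_at_naeval (N r).
have fr : lspan (words (dlexlt^~ (wordof (i r)))) (f - c r *: naeval (i r)).
  rewrite /f (bigD1 r) //= addrAC subrr add0r; apply: big_ind => [|x y|r' r'r].
  - exact: lspan0.
  - exact: lspanD.
  have [->|c'] := eqVneq (c r') 0; first by rewrite scale0r; apply: lspan0.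
  apply: lspanZ; apply: words_sub (monic_at_le (monic_at_naeval (N r'))) => u.
  move/dlexle_lt_trans; apply.
  case/orP: (maxr r' c') => // /eqP/(NLSW_inj (N _) (N _))/inj E.
  by rewrite E eqxx in r'r.
have fw : mcoeff (FMonom (wordof (i r))) f != 0.
  by rewrite (monic_at_coef Mr fr).
have f0 : f <> 0 by move=> E; rewrite E mcoeff0 eqxx in fw.
have lf : lead f = wordof (i r).
  apply: lead_eq fw _; rewrite -[f](subrK (c r *: naeval (i r))); apply: lspanD.
    by apply: words_sub fr => u lt; rewrite /dlexle lt orbT.
  exact/lspanZ/monic_at_le.
have [s [a [b [Ss E]]]] := Hdiv f If f0.
by case: (Ri r) => _ /(_ a b s Ss); rewrite -lf.
Qed.

Lemma Red_basis : (exists s, S s) -> lead_divisible ->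
  quotient_basis Lie (IdLie S) (Red S) (@naeval d X k).
Proof.
move=> [s Ss] Hdiv; split=> [t _|n c i inj Ri|f Lf]; first exact: Lie_naeval.
  exact: Red_independent.
(* Any bound strictly above [lead f] will do; [lead s] is nonempty, so this word is longer. *)
have [|n [c [i [_ Ri _ Hn]]]] := @Lie_reduce (lead s ++ lead f) f Lf.
  apply: words_sub (below_lead f) => u /dlexle_lt_trans; apply.
  rewrite /dlexlt size_cat -[ltnLHS]add0n ltn_add2r.
  by case: (lead s) (ALSW_neq0 (lead_S Ss)).
by exists n, c, i; split=> //; apply: normal_below_IdLie Hn.
Qed.

(** A composition is a difference of two elements of the ideal, both monic with leading word [w]. *)
Lemma composition_below f g w h : S f -> S g ->
  inclusion_comp phi f g w h \/ intersection_comp phi f g w h ->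
  IdLie S h /\ lspan (words (dlexlt^~ w)) h.
Proof.
have cancel w' x y : monic_at w' x -> monic_at w' y ->
  lspan (words (dlexlt^~ w')) (x - y).
  by move=> Mx /lspanBC; apply: lspan_trans.
move=> Sf Sg [[a [b [h' [Ef Eg N ->]]]]|[a [b [h1 [h2 [Ef Eg _ [N1 N2] ->]]]]]].
  split.
    by apply: IdLieB; [apply: IdLie_gen | apply: IdLie_normal_word N].
  apply: cancel; first by rewrite Ef; apply: monic_at_lead; apply: S_monic.
  by rewrite Eg; apply: normal_word_monic.
split.
  by apply: IdLieB; [apply: IdLie_normal_word N1 | apply: IdLie_normal_word N2].
apply: cancel; first by rewrite Ef; apply: (normal_word_monic Sf N1).
by rewrite Eg -[lead g]cats0; apply: (normal_word_monic Sg N2).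
Qed.

Lemma Red_basis_GSbasis :
  quotient_basis Lie (IdLie S) (Red S) (@naeval d X k) -> GSbasis phi S.
Proof.
move=> [_ indep _] f g w h Sf Sg /(composition_below Sf Sg)[Ih hw].
have [n [c [i [inj Ri _ Hn]]]] := Lie_reduce (IdLie_Lie S_Lie Ih) hw.
have c0 : forall r, c r = 0.
  (* The combination of elements of [Red S] is [h] minus normal words, hence lies in the ideal. *)
  apply: (indep n c i inj Ri); rewrite -[\sum_r _](subKr h).
  exact: IdLieB (normal_below_IdLie Hn).
apply: normal_below_trivial; move: Hn; rewrite big1 ?subr0 // => r _.
by rewrite c0 scale0r.
Qed.

End CompositionDiamond.

Theorem theorem5p8 (k : fieldType) (d : Order.disp_t) (X : orderType d)
    (hX : well_founded (fun x y : X => (x < y)%O))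
    (phi : seq X -> seq X -> seq X -> seq X) (hphi : shirshov_choice phi)
    (S : {malg k[{fmonom X}]} -> Prop)
    (hS0 : exists s, S s)
    (hS : forall s, S s -> Lie s /\ dl_monic s) :
  [<-> GSbasis phi S;
       forall f, IdLie S f -> f <> 0%R ->
         exists s a b, S s /\ lead f = a ++ lead s ++ b;
       forall f, IdLie S f -> f <> 0%R -> decreasing_expansion phi S f;
       quotient_basis Lie (IdLie S) (Red S) naeval].
Proof.
have S_Lie s : S s -> Lie s by case/hS.
have S_monic s : S s -> dl_monic s by case/hS.
tfae.
- exact: (GSbasis_lead hX hphi S_Lie S_monic).
- move=> Hdiv f.
  exact: (lead_divisible_expansion hX hphi S_Lie S_monic Hdiv).
- move=> Hexp; apply: (Red_basis hX hphi S_Lie S_monic hS0) => f If f0.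
  (* The first term of a decreasing expansion carries the leading word, so (ii') gives back (ii). *)
  have [n [_ [a [b [s [_ [Ss _ _ E _]]]]]]] := Hexp f If f0.
  by exists (s ord0), (a ord0), (b ord0).
- exact: (Red_basis_GSbasis hX hphi S_Lie S_monic).
Qed.
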